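(* Let $\mathcal{X}$ and $\mathcal{Y}$ be infinite-dimensional Banach spaces over $\mathbb{F}\in\{\mathbb{R},\mathbb{C}\}$, and let $\mathcal{A}\subseteq\mathcal{B}(\mathcal{X})$ and $\mathcal{B}\subseteq\mathcal{B}(\mathcal{Y})$ be standard operator algebras. Let $\phi:\mathcal{A}\to\mathcal{B}$ be a bijective map. Then the following statements are equivalent: (1) $\phi$ is completely quadratic preserving in both directions, i.e. for every $n\in\mathbb{N}$ and every $T\in \mathcal{A}\otimes M_n$, $T$ is quadratic if and only if $\phi_n(T)$ is quadratic. (2) $\phi$ is 2-quadratic preserving in both directions, i.e. for every $T\in\mathcal{A}\otimes M_2$, $T$ is quadratic if and only if $\phi_2(T)$ is quadratic. (3) There exist a bounded invertible linear or (in the complex case) conjugate-linear operator $A:\mathcal{X}\to\mathcal{Y}$ and a scalar $\lambda$ such that $\phi(T)=\lambda ATA^{-1}$ for all $T\in\mathcal{A}$.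
   Context: $\mathcal{B}(\mathcal{X})$ denotes the algebra of bounded linear operators on $\mathcal{X}$. A standard operator algebra on $\mathcal{X}$ is a norm-closed subalgebra of $\mathcal{B}(\mathcal{X})$ containing the identity $I$ and all finite-rank operators. An operator $T$ (on a Banach space, or an $n\times n$ operator matrix viewed as an operator on $\mathcal{X}^n$) is quadratic if there exist scalars $a,b$ with $(T-aI)(T-bI)=0$. For a map $\phi:\mathcal{A}\to\mathcal{B}$ and $n\in\mathbb{N}$, $\phi_n:\mathcal{A}\otimes M_n\to\mathcal{B}\otimes M_n$ is defined by $\phi_n((a_{ij})_{n\times n})=(\phi(a_{ij}))_{n\times n}$, where $\mathcal{A}\otimes M_n$ denotes $n\times n$ matrices with entries in $\mathcal{A}$, acting on $\mathcal{X}^n$. *)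

(* Defs.v *)
From HB Require Import structures.
From mathcomp Require Import all_boot all_order all_algebra.
From mathcomp Require Import all_classical all_reals all_analysis.
From mathcomp Require Import complex.
Import numFieldNormedType.Exports.
Set Implicit Arguments. Unset Strict Implicit. Unset Printing Implicit Defensive.
Import Order.TTheory GRing.Theory Num.Theory.
Local Open Scope ring_scope.
Local Open Scope classical_set_scope.

Section OpDefs.
Variable F : numFieldType.

Definition lin_map (X Y : normedModType F) (T : X -> Y) : Prop :=
  forall (a : F) (x y : X), T (a *: x + y) = a *: T x + T y.

Definition conjlin_map (cj : F -> F) (X Y : normedModType F) (T : X -> Y) : Prop :=
  forall (a : F) (x y : X), T (a *: x + y) = cj a *: T x + T y.

Definition bounded_op (X : normedModType F) (T : X -> X) : Prop :=
  lin_map T /\ continuous T.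

Definition finite_rank (X : normedModType F) (T : X -> X) : Prop :=
  exists (n : nat) (v : 'I_n -> X),
    forall x : X, exists c : 'I_n -> F, T x = \sum_(i < n) c i *: v i.

Definition infinite_dim (X : normedModType F) : Prop :=
  forall (n : nat) (v : 'I_n -> X),
    exists x : X, forall c : 'I_n -> F, x <> \sum_(i < n) c i *: v i.

Definition standard_op_alg (X : normedModType F) (A : set (X -> X)) : Prop :=
  (forall T, A T -> bounded_op T) /\
  (forall S T, A S -> A T -> A (fun x => S x + T x)) /\
  (forall (a : F) T, A T -> A (fun x => a *: T x)) /\
  (forall S T, A S -> A T -> A (S \o T)) /\
  A id /\
  (forall T, bounded_op T -> finite_rank T -> A T) /\
  (forall T, bounded_op T ->
     (forall e : F, 0 < e -> exists S, A S /\
         forall x : X, `|T x - S x| <= e * `|x|) -> A T).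

Definition mx_apply (X : normedModType F) (n : nat) (T : 'M[X -> X]_n)
  (v : 'I_n -> X) : 'I_n -> X :=
  fun i => \sum_(j < n) T i j (v j).

Definition quadratic_mx (X : normedModType F) (n : nat) (T : 'M[X -> X]_n) : Prop :=
  exists a b : F, forall v : 'I_n -> X,
    let w := fun i => mx_apply T v i - b *: v i in
    (fun i => mx_apply T w i - a *: w i) = (fun _ => 0).

Definition ampl (X Y : normedModType F) (phi : (X -> X) -> (Y -> Y)) (n : nat)
  (T : 'M[X -> X]_n) : 'M[Y -> Y]_n := map_mx phi T.

Definition mx_in (X : normedModType F) (A : set (X -> X)) (n : nat)
  (T : 'M[X -> X]_n) : Prop := forall i j, A (T i j).

Definition bij_between (X Y : normedModType F) (A : set (X -> X)) (B : set (Y -> Y))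
  (phi : (X -> X) -> (Y -> Y)) : Prop :=
  [/\ (forall T, A T -> B (phi T)),
      (forall S T, A S -> A T -> phi S = phi T -> S = T) &
      (forall T', B T' -> exists T, A T /\ phi T = T')].

Definition n_quad_pres (X Y : normedModType F) (A : set (X -> X))
  (phi : (X -> X) -> (Y -> Y)) (n : nat) : Prop :=
  forall T : 'M[X -> X]_n, mx_in A T ->
    (quadratic_mx T <-> quadratic_mx (ampl phi T)).

(* The theorem for a fixed scalar field F with conjugation cj
   (cj = id in the real case, so conjugate-linear = linear there). *)
Definition thm1p1_for (cj : F -> F) : Prop :=
  forall (X Y : completeNormedModType F) (A : set (X -> X)) (B : set (Y -> Y))
         (phi : (X -> X) -> (Y -> Y)),
    infinite_dim X -> infinite_dim Y ->
    standard_op_alg A -> standard_op_alg B ->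
    bij_between A B phi ->
    ((forall n, n_quad_pres A phi n) <-> n_quad_pres A phi 2) /\
    (n_quad_pres A phi 2 <->
      exists (U : X -> Y) (V : Y -> X) (lam : F),
        (lin_map U \/ conjlin_map cj U) /\
        continuous U /\ continuous V /\
        cancel U V /\ cancel V U /\
        (forall T, A T -> phi T = (fun y => lam *: U (T (V y))))).

End OpDefs.

(* Main.v *)
Require Import Defs.
From mathcomp Require Import all_boot all_order all_algebra.
From mathcomp Require Import all_classical all_reals all_analysis.
From mathcomp Require Import complex.
From mathcomp Require Import ring lra.
Import numFieldNormedType.Exports.
Set Implicit Arguments. Unset Strict Implicit. Unset Printing Implicit Defensive.
Import Order.TTheory GRing.Theory Num.Theory.
Local Open Scope ring_scope.
Local Open Scope classical_set_scope.

(* Write x f for the operator z |-> f(z) x.  Quadraticity of [[S, T], [U, V]]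
   means S^2 + TU = s S - p, ST + TV = s T, US + VU = s U, UT + V^2 = s V - p
   for some s, p, and every property of phi is read off well chosen blocks.

   - phi sends scalars to scalars, so phi(I) = I may be assumed; then phi
     preserves the relations S^2 = c S, ST = c T and TS = c T up to c |-> tau c.
   - Hence phi(x0 f0) has rank one for an idempotent x0 f0, and the blocks
     x0 f0, x0 f, x f0, x f give phi(x f) = alpha(x) beta(f) for all x and f,
     with beta(f)(alpha(x)) = tau(f(x)).
   - If f(Tx) = -1, the matrix [[-x (f T), x f], [T, (Tx) f]] squares to zero,
     which yields phi(T) alpha(x) = alpha(Tx).  Comparing phi(I - S) with
     s - phi(S) for S of rank one makes alpha additive, so that tau is a field
     automorphism and alpha is tau-semilinear.
   - A gliding hump argument based on the functionals g o alpha = tau o f shows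
     first, by infinite dimension, that tau is bounded near 0, hence is the
     identity or the conjugation, and then that alpha is continuous.

   Rank-one operators are provided by the Hahn-Banach theorem, proved by taking
   a minimal sublinear functional. *)

(** * Functionals, rank-one operators and 2 x 2 blocks *)

Definition dual (F : numFieldType) (X : normedModType F) (f : X -> F) : Prop :=
  (forall a x y, f (a *: x + y) = a * f x + f y) /\ continuous f.

(** The Hahn-Banach property of the scalar field, isolated so that the argument is uniform in [F];
    it is proved for the real and the complex numbers further on. *)
Definition norming (F : numFieldType) : Prop :=
  forall (X : normedModType F) (x : X),
    exists f : X -> F, [/\ dual f, f x = `|x| & forall z, `|f z| <= `|z|].

Section Functionals.
Variables (F : numFieldType) (X : normedModType F).
Implicit Types (f g : X -> F) (x y z : X) (a b c : F).

Lemma dualD f x y : dual f -> f (x + y) = f x + f y.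
Proof. by move=> [h _]; rewrite -{1}[x]scale1r h mul1r. Qed.

Lemma dual0 f : dual f -> f 0 = 0.
Proof. by move=> h; apply: (addrI (f 0)); rewrite -dualD// !addr0. Qed.

Lemma dualZ f c x : dual f -> f (c *: x) = c * f x.
Proof. by move=> h; rewrite -[_ *: x]addr0 h.1 dual0// addr0. Qed.

Lemma dualN f x : dual f -> f (- x) = - f x.
Proof. by move=> h; rewrite -scaleN1r dualZ// mulN1r. Qed.

Lemma dualB f x y : dual f -> f (x - y) = f x - f y.
Proof. by move=> h; rewrite dualD// dualN. Qed.

Lemma dualE f : dual f ->
  (forall x y, f (x + y) = f x + f y) * (forall x y, f (x - y) = f x - f y) *
  (forall c x, f (c *: x) = c * f x) * (forall x, f (- x) = - f x) * (f 0 = 0).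
Proof.
move=> h; split; last exact: dual0.
split=> [|x]; last exact: dualN.
split=> [|c x]; last exact: dualZ.
by split=> x y; [exact: dualD | exact: dualB].
Qed.

Lemma dual_scale f c : dual f -> dual (fun z => c * f z).
Proof.
move=> [fl fc]; split=> [a x y /=|x]; first by rewrite fl; ring.
by apply: cvgM; [exact: cvg_cst | exact: fc].
Qed.

End Functionals.

Lemma dual_ext (F : numFieldType) (X : normedModType F) (x y : X) :
  norming F -> (forall f, dual f -> f x = f y) -> x = y.
Proof.
move=> Fnorming h; apply/eqP; rewrite -subr_eq0 -normr_eq0.
by have [f [fd <- _]] := Fnorming _ (x - y); rewrite dualB// h// subrr.
Qed.

(* Vector identities become scalar ones once every functional is applied. *)
Ltac dual_ring norming_hyp :=
  let f := fresh "f" in let fd := fresh "fd" in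
  apply: (dual_ext norming_hyp) => f fd;
  rewrite ?(dualE fd);
  ring.

(** * Rank-one operators, scalar operators and quadratic block matrices *)

Section Operators.
Variables (F : numFieldType) (X : normedModType F).
Implicit Types (A B C D T : X -> X) (f : X -> F) (x y z : X) (a b c : F).

Definition rk x f : X -> X := fun z => f z *: x.
Definition scal c : X -> X := fun z => c *: z.

Lemma scal0E : scal 0 = fun=> 0.
Proof. by apply/funext => x; rewrite /scal scale0r. Qed.

Lemma scal1E : scal 1 = id.
Proof. by apply/funext => x; rewrite /scal scale1r. Qed.

Lemma linD T x y : lin_map T -> T (x + y) = T x + T y.
Proof. by move=> h; rewrite -{1}[x]scale1r h scale1r. Qed.

Lemma lin0 T : lin_map T -> T 0 = 0.
Proof. by move=> h; apply: (addrI (T 0)); rewrite -linD// !addr0. Qed.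

Lemma linZ T c x : lin_map T -> T (c *: x) = c *: T x.
Proof. by move=> h; rewrite -[_ *: x]addr0 h lin0// addr0. Qed.

Lemma linN T x : lin_map T -> T (- x) = - T x.
Proof. by move=> h; rewrite -scaleN1r linZ// scaleN1r. Qed.

Lemma linB T x y : lin_map T -> T (x - y) = T x - T y.
Proof. by move=> h; rewrite linD// linN. Qed.

Lemma dual_comp f T : dual f -> bounded_op T -> dual (f \o T).
Proof.
move=> [fl fc] [Tl Tc]; split=> [a x y /=|x]; first by rewrite Tl fl.
by apply: continuous_comp; [exact: Tc | exact: fc].
Qed.

Lemma linE T : lin_map T ->
  (forall x y, T (x + y) = T x + T y) * (forall x y, T (x - y) = T x - T y) *
  (forall c x, T (c *: x) = c *: T x) * (forall x, T (- x) = - T x) * (T 0 = 0).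
Proof.
move=> h; split; last exact: lin0.
split=> [|x]; last exact: linN.
split=> [|c x]; last exact: linZ.
by split=> x y; [exact: linD | exact: linB].
Qed.

Lemma rk_bounded x f : dual f -> bounded_op (rk x f).
Proof.
move=> [fl fc]; split=> [a u v|u]; first by rewrite /rk fl scalerDl scalerA.
by apply: cvgZr_tmp; exact: fc.
Qed.

Lemma rk_finite_rank x f : finite_rank (rk x f).
Proof.
exists 1%N, (fun=> x) => z; exists (fun=> f z).
by rewrite big_ord_recl big_ord0 addr0.
Qed.

(** The entries of [M^2 = (a + b) M - a b I] for [M = [[A, B], [C, D]]]. *)
Definition quad4 A B C D := exists a b, [/\
  forall x, A (A x) + B (C x) = (a + b) *: A x - (a * b) *: x,
  forall x, A (B x) + B (D x) = (a + b) *: B x,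
  forall x, C (A x) + D (C x) = (a + b) *: C x &
  forall x, C (B x) + D (D x) = (a + b) *: D x - (a * b) *: x].

Definition blk A B C D : 'M[X -> X]_2 :=
  \matrix_(i < 2, j < 2)
    (if i == ord0 then if j == ord0 then A else B
     else if j == ord0 then C else D).

Lemma blk_apply A B C D (v : 'I_2 -> X) :
  mx_apply (blk A B C D) v =
  fun i => if i == ord0 then A (v ord0) + B (v ord_max)
           else C (v ord0) + D (v ord_max).
Proof.
apply/funext => i; rewrite /mx_apply big_ord_recl big_ord1 !mxE /=.
have -> : lift ord0 ord0 = ord_max :> 'I_2 by apply/val_inj.
by case: ifP.
Qed.

Hypothesis Fnorming : norming F.

Lemma quad4P A B C D : lin_map A -> lin_map B -> lin_map C -> lin_map D ->
  quadratic_mx (blk A B C D) <-> quad4 A B C D.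
Proof.
move=> hA hB hC hD.
have lins := (linE hA, linE hB, linE hC, linE hD).
split=> [[a [b q]]|[a [b [q1 q2 q3 q4]]]]; exists a, b.
(* The two columns of the matrix identity are read off on the vectors (x, 0) and (0, x). *)
- pose e1 x (i : 'I_2) := if i == ord0 then x else 0 : X.
  pose e2 x (i : 'I_2) := if i == ord0 then 0 else x : X.
  split=> x; apply: subr0_eq.
  + have := congr1 (@^~ ord0) (q (e1 x)).
    by rewrite /= !blk_apply /e1 /= => E; rewrite -[RHS]E !lins; dual_ring Fnorming.
  + have := congr1 (@^~ ord0) (q (e2 x)).
    by rewrite /= !blk_apply /e2 /= => E; rewrite -[RHS]E !lins; dual_ring Fnorming.
  + have := congr1 (@^~ ord_max) (q (e1 x)).
    by rewrite /= !blk_apply /e1 /= => E; rewrite -[RHS]E !lins; dual_ring Fnorming.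
  + have := congr1 (@^~ ord_max) (q (e2 x)).
    by rewrite /= !blk_apply /e2 /= => E; rewrite -[RHS]E !lins; dual_ring Fnorming.
- move=> v w; apply/funext => i; rewrite /w !blk_apply /=.
  set x := v ord0; set y := v ord_max.
  have -> : (v i = if i == ord0 then x else y).
    case: eqP => [->//|/eqP ne]; congr v; apply/val_inj => /=.
    by case: i ne => -[|[|]].
  case: (i =P ord0) => _; rewrite !lins.
  + have -> := canRL (addrK _) (q1 x); have -> := canRL (addrK _) (q2 y).
    by dual_ring Fnorming.
  + have -> := canRL (addrK _) (q3 x); have -> := canRL (addrK _) (q4 y).
    by dual_ring Fnorming.
Qed.
End Operators.

(** * Closure properties of standard operator algebras *)

Section StandardAlgebras.
Variables (F : numFieldType) (X : normedModType F) (A : set (X -> X)).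
Hypothesis Astd : standard_op_alg A.
Implicit Types (S T : X -> X) (f : X -> F) (x : X) (c : F).

Lemma std_bounded T : A T -> bounded_op T.
Proof. by case: Astd => h _; exact: h. Qed.

Lemma std_lin T : A T -> lin_map T.
Proof. by move=> /std_bounded[]. Qed.

Lemma std_add S T : A S -> A T -> A (fun x => S x + T x).
Proof. by case: Astd => _ [h _]; exact: h. Qed.

Lemma std_scale c T : A T -> A (fun x => c *: T x).
Proof. by case: Astd => _ [_ [h _]]; exact: h. Qed.

Lemma std_comp S T : A S -> A T -> A (S \o T).
Proof. by case: Astd => _ [_ [_ [h _]]]; exact: h. Qed.

Lemma std_id : A id.
Proof. by case: Astd => _ [_ [_ [_ [h _]]]]. Qed.

Lemma std_scal c : A (scal c).
Proof. exact: (std_scale c std_id). Qed.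

Lemma std_rk x f : dual f -> A (rk x f).
Proof.
move=> fd; case: Astd => _ [_ [_ [_ [_ [h _]]]]].
by apply: h; [exact: rk_bounded | exact: rk_finite_rank].
Qed.

Lemma std_sub S T : A S -> A T -> A (fun x => S x - T x).
Proof.
move=> aS aT; have -> : (fun x => S x - T x) = fun x => S x + (-1) *: T x.
  by apply/funext => x; rewrite scaleN1r.
exact: std_add aS (std_scale _ aT).
Qed.

End StandardAlgebras.

(** * Common kernels of finitely many functionals *)

Section InfiniteDimension.
Variables (F : numFieldType) (X : normedModType F).
Hypothesis Xinf : infinite_dim X.

(* Each functional lowers the codimension of a finite intersection of kernels
   by at most one: [x - f x *: e] lies in the kernel of [f] when [f e = 1]. *)
Lemma kernels_not_finite_dim (L : seq (X -> F)) n (v : 'I_n -> X) :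
  (forall f, f \in L -> dual f) ->
  exists x, (forall f, f \in L -> f x = 0) /\
    forall c : 'I_n -> F, x <> \sum_(i < n) c i *: v i.
Proof.
elim: L n v => [|f L IH] n v Ld.
  by have [x hx] := Xinf v; exists x.
have {}IH m (w : 'I_m -> X) := IH m w (fun g gL => Ld g (@mem_behead _ (f :: L) g gL)).
have fd : dual f by apply: Ld; rewrite mem_head.
have [[e [eL fe]]|nfe] :=
  pselect (exists e, (forall g, g \in L -> g e = 0) /\ f e != 0); last first.
  have [x [xL xv]] := IH _ v; exists x; split=> // g.
  rewrite inE => /orP[/eqP ->|/xL//]; apply: contrapT => /eqP fx.
  by apply: nfe; exists x.
pose w (i : 'I_n.+1) := if unlift ord0 i is Some j then v j else e.
have [x [xL xw]] := IH _ w; exists (x - (f x / f e) *: e); split=> [g|c].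
  rewrite inE => /orP[/eqP ->|gL].
    by rewrite !(dualE fd) mulfVK// subrr.
  have gd : dual g by apply: Ld; rewrite in_cons gL orbT.
  by rewrite !(dualE gd) (xL _ gL) (eL _ gL) mulr0 subrr.
move=> /(canRL (subrK _)) hx.
apply: (xw (fun i => if unlift ord0 i is Some j then c j else f x / f e)).
rewrite big_ord_recl /w unlift_none addrC [LHS]hx; congr (_ + _).
by apply: eq_bigr => i _; rewrite liftK.
Qed.

Lemma kernels_nontrivial (L : seq (X -> F)) :
  (forall f, f \in L -> dual f) -> exists2 x, x != 0 & forall f, f \in L -> f x = 0.
Proof.
move=> Ld; have [x [xL xv]] := kernels_not_finite_dim (fun=> 0 : X) Ld (n := 0).
exists x => //; apply/eqP => x0; apply: (xv (fun=> 0)).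
by rewrite big_ord0.
Qed.

Lemma kernel_nontrivial (f : X -> F) : dual f -> exists2 x, x != 0 & f x = 0.
Proof.
move=> fd; have [|x x0 xf] := @kernels_nontrivial [:: f].
  by move=> g; rewrite inE => /eqP ->.
by exists x => //; apply: xf; rewrite mem_head.
Qed.

Lemma nonzero_vector : exists x : X, x != 0.
Proof. by have [//|x x0 _] := @kernels_nontrivial [::]; exists x. Qed.

End InfiniteDimension.

(** * Relations preserved by a 2-quadratic bijection *)

(** Carrying the inverse [psi] makes the hypotheses symmetric, so that every result on [phi] also
    applies to [psi]. *)
Record quadratic_bijection (F : numFieldType) (X Y : normedModType F) (A : set (X -> X))
    (B : set (Y -> Y)) (phi : (X -> X) -> (Y -> Y)) (psi : (Y -> Y) -> (X -> X)) :
    Prop := QuadraticBijection {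
  q_stdA : standard_op_alg A;
  q_stdB : standard_op_alg B;
  q_infX : infinite_dim X;
  q_infY : infinite_dim Y;
  q_phiB : forall T, A T -> B (phi T);
  q_psiA : forall S, B S -> A (psi S);
  q_phiK : forall T, A T -> psi (phi T) = T;
  q_psiK : forall S, B S -> phi (psi S) = S;
  q_quad : n_quad_pres A phi 2 }.

Lemma ampl_blk (F : numFieldType) (X Y : normedModType F)
    (phi : (X -> X) -> (Y -> Y)) S T U V :
  ampl phi (blk S T U V) = blk (phi S) (phi T) (phi U) (phi V).
Proof. by apply/matrixP => i j; rewrite !mxE; do 2!case: ifP. Qed.

Lemma quadratic_bijection_sym (F : numFieldType) (X Y : normedModType F) (A : set (X -> X))
    (B : set (Y -> Y)) phi psi : quadratic_bijection A B phi psi -> quadratic_bijection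
      B A psi phi.
Proof.
case=> sA sB iX iY pB pA pK qK q; split=> // T TB.
have TK : ampl phi (ampl psi T) = T.
  by apply/matrixP => i j; rewrite !mxE qK.
by rewrite -{1}TK; split=> /(q (ampl psi T) _); apply=> i j; rewrite mxE; apply: pA.
Qed.

Lemma scale_vec_inj (F : fieldType) (X : lmodType F) (x : X) :
  x != 0 -> injective (fun c : F => c *: x).
Proof.
move=> x0 a b /eqP; rewrite -subr_eq0 -scalerBl scaler_eq0 (negbTE x0) orbF.
by rewrite subr_eq0 => /eqP.
Qed.

Section QuadraticPreservers.
Variables (F : numFieldType).
Hypothesis Fnorming : norming F.

Lemma dual_separates (X : normedModType F) (x : X) :
  x != 0 -> exists2 f : X -> F, dual f & f x = 1.
Proof.
move=> x0; have [f [fd fx _]] := Fnorming x.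
exists (fun z => `|x|^-1 * f z); first exact: dual_scale.
by rewrite fx mulVf// normr_eq0.
Qed.

Section OneDirection.
Variables (X Y : normedModType F) (A : set (X -> X)) (B : set (Y -> Y)).
Variables (phi : (X -> X) -> (Y -> Y)) (psi : (Y -> Y) -> (X -> X)).
Hypothesis phiP : quadratic_bijection A B phi psi.
Implicit Types (S T U V N : X -> X) (s c p : F).

Let sA := q_stdA phiP.
Let sB := q_stdB phiP.
Let linA T := @std_lin _ _ _ sA T.
Let linB T (h : A T) := @std_lin _ _ _ sB _ (q_phiB phiP h).

(** All block matrices used below satisfy [M^2 = s M], with roots [s] and 0. The roots of the image
    are unknown: [s'] is their sum and [p'] their product. *)
Lemma phi_quad4 S T U V s : A S -> A T -> A U -> A V ->
  (forall x, S (S x) + T (U x) = s *: S x) ->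
  (forall x, S (T x) + T (V x) = s *: T x) ->
  (forall x, U (S x) + V (U x) = s *: U x) ->
  (forall x, U (T x) + V (V x) = s *: V x) ->
  exists s' p', [/\
    forall y, phi S (phi S y) + phi T (phi U y) = s' *: phi S y - p' *: y,
    forall y, phi S (phi T y) + phi T (phi V y) = s' *: phi T y,
    forall y, phi U (phi S y) + phi V (phi U y) = s' *: phi U y &
    forall y, phi U (phi T y) + phi V (phi V y) = s' *: phi V y - p' *: y].
Proof.
move=> aS aT aU aV h1 h2 h3 h4.
have q : quadratic_mx (blk S T U V).
  apply/(quad4P Fnorming (linA aS) (linA aT) (linA aU) (linA aV)); exists s, 0.
  by rewrite addr0 mulr0; split=> x; rewrite ?h1 ?h2 ?h3 ?h4 ?scale0r ?subr0.
move: q => /(q_quad phiP _) q.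
have {q} := q _; rewrite ampl_blk.
move/(_ _)/(quad4P Fnorming (linB aS) (linB aT) (linB aU) (linB aV)).
case=> [|a [b [e1 e2 e3 e4]]]; last by exists (a + b), (a * b).
by move=> i j; rewrite mxE; do 2!case: ifP.
Qed.

Lemma std_zero : A (fun=> 0).
Proof. by rewrite -scal0E; exact: std_scal. Qed.

(** Matrices [[0, T], [0, 0]] square to zero. With [T = psi id], the upper right entry for the image
    says that twice [Z] is scalar; with [T = psi (rk y g)], that scalar is forced to vanish. *)
Lemma phi_zero : phi (fun=> 0) = fun=> 0.
Proof.
set Z := phi _.
have aT := q_psiA phiP (std_id sB).
have lZ : lin_map Z := linB std_zero.
have [s [p []]] : exists s p, [/\
    forall y, Z (Z y) + Z y = s *: Z y - p *: y,
    forall y, Z y + Z y = s *: y, forall y, Z (Z y) + Z (Z y) = s *: Z y &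
    forall y, Z y + Z (Z y) = s *: Z y - p *: y].
  have := @phi_quad4 (fun=> 0) (psi id) (fun=> 0) (fun=> 0) 0 std_zero aT std_zero std_zero.
  rewrite (q_psiK phiP (std_id sB)) -/Z; apply=> x;
    by rewrite ?(linE (linA aT)) ?scale0r ?addr0.
move=> _ h _ _.
have {h}Zz y : Z y = (s / 2) *: y.
  apply: (@scalerI _ _ 2); first by rewrite pnatr_eq0.
  by rewrite scalerA mulrC divfK ?pnatr_eq0// -h scaler_nat mulr2n.
move: (s / 2) Zz => {s p} z Zz.
suff z0 : z = 0 by apply/funext => y; rewrite Zz z0 scale0r.
have [y y0] := nonzero_vector (q_infY phiP).
have [g gd gy] := dual_separates y0.
have [k k0 gk] := kernel_nontrivial (q_infY phiP) gd.
have aR := q_psiA phiP (std_rk sB y gd).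
have [x|x|x|x|s [p []]] := @phi_quad4 (fun=> 0) (psi (rk y g)) (fun=> 0) (fun=> 0) 0
  std_zero aR std_zero std_zero.
- by rewrite (linE (linA aR)) scale0r addr0.
- by rewrite (linE (linA aR)) scale0r addr0.
- by rewrite scaler0 addr0.
- by rewrite scaler0 addr0.
rewrite (q_psiK phiP (std_rk sB y gd)) -/Z /rk => e1 e2 _ _.
(* The upper right entry at [y] gives [s = 2 z], the upper left one on the kernel of [g] gives
   [p = z^2], and the upper left one at [y] then reads [z^2 + z = z^2]. *)
have {e2} hs : s = z + z.
  by apply: (scale_vec_inj y0); move: (e2 y);
    rewrite !Zz gy !(dualE gd) gy !(mulr1, scale1r) scalerDl.
have hp : p = z * z.
  apply: (scale_vec_inj k0); move: (e1 k).
  rewrite !Zz !(dualE gd) gk mulr0 scale0r addr0 !scalerA => E.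
  transitivity ((s * z) *: k - (z * z) *: k); first by rewrite E; dual_ring Fnorming.
  by rewrite hs; dual_ring Fnorming.
apply: (scale_vec_inj y0); move: (e1 y).
rewrite !Zz !(dualE gd) gy mulr1 scale0r !scalerA => E.
transitivity (((z * z) *: y + z *: y) - (z * z) *: y); first by dual_ring Fnorming.
by rewrite E hs hp; dual_ring Fnorming.
Qed.

(** The matrix [[c, psi id], [0, 0]] satisfies [M^2 = c M], and the upper right entry for its image
    says that [phi (scal c)] is the scalar [s]. *)
Lemma phi_scal c : exists d, phi (scal c) = scal d.
Proof.
have aT := q_psiA phiP (std_id sB).
have aS := std_scal sA c.
have [x|x|x|x|s [p [_ e _ _]]] :=
    @phi_quad4 (scal c) (psi id) (fun=> 0) (fun=> 0) c aS aT std_zero std_zero.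
- by rewrite (linE (linA aT)) addr0.
- by rewrite (linE (linA aT)) addr0.
- by rewrite scaler0 addr0.
- by rewrite scaler0 addr0.
exists s; apply/funext => y; move: (e y).
by rewrite (q_psiK phiP (std_id sB)) phi_zero addr0.
Qed.

Lemma phi_inj S T : A S -> A T -> phi S = phi T -> S = T.
Proof. by move=> aS aT e; rewrite -(q_phiK phiP aS) e (q_phiK phiP). Qed.

(** The matrix is [[S, T], [0, 0]]. As [phi] sends 0 to 0, the lower right entry for the image makes
    the constant term vanish. *)
Lemma phi_quad4_row S T s : A S -> A T ->
  (forall x, S (S x) = s *: S x) -> (forall x, S (T x) = s *: T x) ->
  exists s', (forall y, phi S (phi S y) = s' *: phi S y) /\
    (forall y, phi S (phi T y) = s' *: phi T y).
Proof.
move=> aS aT h1 h2.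
have [x|x|x|x|s' [p [e1 e2 _ e3]]] :=
    @phi_quad4 S T (fun=> 0) (fun=> 0) s aS aT std_zero std_zero.
- by rewrite (linE (linA aT)) addr0.
- by rewrite (linE (linA aT)) addr0.
- by rewrite scaler0 addr0.
- by rewrite scaler0 addr0.
rewrite !phi_zero in e1 e2 e3; exists s'; split=> y.
  move: (e3 y); rewrite scaler0 addr0 sub0r => /esym/eqP.
  by rewrite oppr_eq0 -(subr0 (s' *: phi S y)) => /eqP <-;
    rewrite -e1 (linE (linB aT)) addr0.
by rewrite -e2 (linE (linB aT)) addr0.
Qed.

Lemma phi_quad4_col S T s : A S -> A T ->
  (forall x, S (S x) = s *: S x) -> (forall x, T (S x) = s *: T x) ->
  exists s', (forall y, phi S (phi S y) = s' *: phi S y) /\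
    (forall y, phi T (phi S y) = s' *: phi T y).
Proof.
move=> aS aT h1 h2.
have [x|x|x|x|s' [p [e1 _ e2 e3]]] :=
    @phi_quad4 S (fun=> 0) T (fun=> 0) s aS std_zero aT std_zero.
- by rewrite addr0.
- by rewrite (linE (linA aS)) scaler0 addr0.
- by rewrite addr0.
- by rewrite (linE (linA aT)) scaler0 addr0.
rewrite !phi_zero in e1 e2 e3; exists s'; split=> y.
  move: (e3 y); rewrite scaler0 addr0 sub0r (linE (linB aT)) => /esym/eqP.
  by rewrite oppr_eq0 -(subr0 (s' *: phi S y)) => /eqP <-; rewrite -e1 addr0.
by rewrite -e2 addr0.
Qed.

(* The scalar block forces [s = c], whereas [S] alone forces the constant
   term to vanish. *)
Lemma phi_eigen_neq0 S c d : A S -> c != 0 -> phi (scal c) = scal d ->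
  (forall y, phi S = scal y -> exists e, S = scal e) ->
  (forall x, S (S x) = c *: S x) -> forall y, phi S (phi S y) = d *: phi S y.
Proof.
move=> aS c0 hd hscal hS.
have [s1 [e1 _]] := phi_quad4_row aS aS hS hS.
have [x|x|x|x|s2 [p [e2 _ _ e3]]] :=
    @phi_quad4 S (fun=> 0) (fun=> 0) (scal c) c aS std_zero std_zero (std_scal sA c).
- by rewrite addr0.
- by rewrite (linE (linA aS)) scaler0 addr0.
- by rewrite /scal !scaler0 addr0.
- by rewrite add0r.
rewrite phi_zero hd /scal in e2 e3.
(* The lower right block of the image is the scalar [d], which is therefore a root of the
   equation. *)
have dp : p = s2 * d - d * d.
  have [y y0] := nonzero_vector (q_infY phiP).
  apply: (scale_vec_inj y0); move: (e3 y); rewrite add0r scalerA => E.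
  transitivity ((s2 * d) *: y - (d * d) *: y); last by dual_ring Fnorming.
  by rewrite E; dual_ring Fnorming.
have dz : d != 0.
  apply/eqP => d0; move: c0; rewrite (_ : c = 0) ?eqxx//.
  have [x x0] := nonzero_vector (q_infX phiP); apply: (scale_vec_inj x0).
  have : scal c = (fun=> 0 : X).
    by apply: phi_inj; [exact: std_scal|exact: std_zero|rewrite hd d0 phi_zero scal0E].
  by move/(congr1 (@^~ x)); rewrite /scal scale0r.
have key y : (s2 - s1) *: phi S y = p *: y.
  have : phi S (phi S y) = s2 *: phi S y - p *: y by rewrite -e2 addr0.
  by rewrite e1 scalerBl => ->; dual_ring Fnorming.
have [s12|s12] := eqVneq s2 s1.
  have p0 : p = 0.
    have [y y0] := nonzero_vector (q_infY phiP); apply: (scale_vec_inj y0).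
    by rewrite -key s12 subrr !scale0r.
  move=> y; rewrite e1 -s12; congr (_ *: _); apply: (mulIf dz).
  by apply/eqP; rewrite -subr_eq0 -dp p0.
(* Two different equations for [phi S] make it scalar; then [S] is a scalar [e] with [e^2 = c e], so
   that [e] is [c] or 0. *)
have [e Se] : exists e, S = scal e.
  apply: (hscal ((s2 - s1)^-1 * p)); apply/funext => y.
  apply: (@scalerI _ _ (s2 - s1)); first by rewrite subr_eq0.
  by rewrite key /scal scalerA mulrA divff ?subr_eq0// mul1r.
have [x x0] := nonzero_vector (q_infX phiP).
have : e * e = c * e.
  by apply: (scale_vec_inj x0); move: (hS x); rewrite Se /scal !scalerA.
move=> /eqP; rewrite -subr_eq0 -mulrBl mulf_eq0 subr_eq0 => /orP[] /eqP e_.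
  by move=> y; rewrite Se e_ hd.
by move=> y; rewrite Se e_ scal0E phi_zero scaler0.
Qed.

End OneDirection.
End QuadraticPreservers.

(** * Relations obtained by using [phi] and [psi] together *)

Section BothDirections.
Variable F : numFieldType.
Hypothesis Fnorming : norming F.

Section Eigen.
Variables (X Y : normedModType F) (A : set (X -> X)) (B : set (Y -> Y)).
Variables (phi : (X -> X) -> (Y -> Y)) (psi : (Y -> Y) -> (X -> X)).
Hypothesis phiP : quadratic_bijection A B phi psi.
Implicit Types (S T : X -> X) (s c d : F).

Let sA := q_stdA phiP.
Let sB := q_stdB phiP.
Let linB T (h : A T) := @std_lin _ _ _ sB _ (q_phiB phiP h).
Let phi0 := phi_zero Fnorming phiP.

Lemma phi_scal_inv S d : A S -> phi S = scal d -> exists e, S = scal e.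
Proof.
move=> aS hS; have [e he] := phi_scal Fnorming (quadratic_bijection_sym phiP) d.
by exists e; rewrite -he -hS (q_phiK phiP).
Qed.

Lemma phi_scal_eq0 c d : phi (scal c) = scal d -> (c == 0) = (d == 0).
Proof.
move=> hd; apply/idP/idP => /eqP e; apply/eqP.
  have [y y0] := nonzero_vector (q_infY phiP); apply: (scale_vec_inj y0).
  by rewrite -[LHS]/(scal d y) -hd e scal0E phi0 scale0r.
have [x x0] := nonzero_vector (q_infX phiP); apply: (scale_vec_inj x0).
suff : scal c = (fun=> 0 : X) by move/(congr1 (@^~ x)); rewrite /scal scale0r.
apply: (phi_inj phiP); [exact: std_scal|exact: (std_zero phiP)|].
by rewrite hd e phi0 scal0E.
Qed.

Lemma phi_eq0 S : A S -> (forall y, phi S y = 0) -> forall x, S x = 0.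
Proof.
move=> aS h x; suff -> : S = fun=> 0 by [].
apply: (phi_inj phiP) => //; first exact: (std_zero phiP).
by rewrite phi0; apply/funext.
Qed.
End Eigen.

Section EigenBoth.
Variables (X Y : normedModType F) (A : set (X -> X)) (B : set (Y -> Y)).
Variables (phi : (X -> X) -> (Y -> Y)) (psi : (Y -> Y) -> (X -> X)).
Hypothesis phiP : quadratic_bijection A B phi psi.
Implicit Types (S T : X -> X) (s c d : F).

Let psiP := quadratic_bijection_sym phiP.
Let sB := q_stdB phiP.
Let linB T (h : A T) := @std_lin _ _ _ sB _ (q_phiB phiP h).
Let phi0 := phi_zero Fnorming phiP.

(** For [c = 0], if the coefficient [s] of [phi S] were nonzero, the nonzero case applied to [psi]
    would give [S^2 = c' S] with [c'] nonzero; as [S^2 = 0], this leaves only [S = 0]. *)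
Lemma phi_eigen S c d : A S -> phi (scal c) = scal d ->
  (forall x, S (S x) = c *: S x) -> forall y, phi S (phi S y) = d *: phi S y.
Proof.
move=> aS hd hS; have [c0|c0] := eqVneq c 0; last first.
  by apply: (phi_eigen_neq0 Fnorming phiP aS c0 hd _ hS) => z; exact: (phi_scal_inv phiP).
have /eqP -> : d == 0 by rewrite -(phi_scal_eq0 phiP hd) c0.
have [s [h _]] := phi_quad4_row Fnorming phiP aS aS hS hS.
have [s0|s0] := eqVneq s 0; first by move=> y; rewrite h s0.
have [c' hc'] := phi_scal Fnorming psiP s.
have BS : B (phi S) := q_phiB phiP aS.
have := phi_eigen_neq0 Fnorming psiP BS s0 hc' _ h; rewrite (q_phiK phiP aS) => h'.
have {}h' x : c' *: S x = 0.
  by rewrite -h' ?hS ?c0 ?scale0r// => z ->; exact: (phi_scal Fnorming phiP).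
have c'0 : c' != 0 by rewrite -(phi_scal_eq0 psiP hc').
suff -> : S = fun=> 0 by rewrite phi0 => y; rewrite scaler0.
by apply/funext => x; apply: (scalerI c'0); rewrite h' scaler0.
Qed.

(** If the coefficient [s] of the row differs from [d], then [phi S = 0], hence [S = 0] and
    [c T = S T = 0]: either [c = d = 0] or [T = 0]. *)
Lemma phi_eigen_row S T c d : A S -> A T -> phi (scal c) = scal d ->
  (forall x, S (S x) = c *: S x) -> (forall x, S (T x) = c *: T x) ->
  forall y, phi S (phi T y) = d *: phi T y.
Proof.
move=> aS aT hd hS hT; have e1 := phi_eigen aS hd hS.
have [s [e2 e3]] := phi_quad4_row Fnorming phiP aS aT hS hT.
have [<- //|sd] := eqVneq s d.
have S0 y : phi S y = 0.
  apply: (@scalerI _ _ (s - d)); first by rewrite subr_eq0.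
  by rewrite scaler0 scalerBl -e1 -e2 subrr.
move=> y; rewrite S0.
have [c0|c0] := eqVneq c 0.
  have /eqP -> : d == 0 by rewrite -(phi_scal_eq0 phiP hd) c0.
  by rewrite scale0r.
suff -> : T = fun=> 0 by rewrite phi0 scaler0.
apply/funext => x; apply: (scalerI c0).
by rewrite -hT (phi_eq0 phiP aS S0) scaler0.
Qed.

Lemma phi_eigen_col S T c d : A S -> A T -> phi (scal c) = scal d ->
  (forall x, S (S x) = c *: S x) -> (forall x, T (S x) = c *: T x) ->
  forall y, phi T (phi S y) = d *: phi T y.
Proof.
move=> aS aT hd hS hT; have e1 := phi_eigen aS hd hS.
have [s [e2 e3]] := phi_quad4_col Fnorming phiP aS aT hS hT.
have [<- //|sd] := eqVneq s d.
have S0 y : phi S y = 0.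
  apply: (@scalerI _ _ (s - d)); first by rewrite subr_eq0.
  by rewrite scaler0 scalerBl -e1 -e2 subrr.
move=> y; rewrite S0 (linE (linB aT)).
have [c0|c0] := eqVneq c 0.
  have /eqP -> : d == 0 by rewrite -(phi_scal_eq0 phiP hd) c0.
  by rewrite scale0r.
suff -> : T = fun=> 0 by rewrite phi0 scaler0.
apply/funext => x; apply: (scalerI c0).
by rewrite -hT (phi_eq0 phiP aS S0) (linE (std_lin (q_stdA phiP) aT)) scaler0.
Qed.

Hypothesis phi1 : phi id = id.

Lemma psi1 : psi id = id.
Proof. by rewrite -{1}phi1 (q_phiK phiP)//; exact: std_id (q_stdA phiP). Qed.

Lemma phi_scal1 : phi (scal 1) = scal 1.
Proof. by rewrite !scal1E. Qed.

(** The matrix [[S, S - S^2], [I, I - S]] is idempotent, and the lower left entry for its image is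
    the claim. *)
Lemma phi_compl S : A S ->
  exists s, forall y, phi (fun x => x - S x) y = s *: y - phi S y.
Proof.
move=> aS; have lS := std_lin (q_stdA phiP) aS.
have aI := std_id (q_stdA phiP).
have aT := std_sub (q_stdA phiP) aS (std_comp (q_stdA phiP) aS aS).
have aV := std_sub (q_stdA phiP) aI aS.
have [x|x|x|x|s [p [_ _ e _]]] := phi_quad4 Fnorming phiP (s := 1) aS aT aI aV.
- by rewrite /= scale1r addrC subrK.
- by rewrite /= !(linE lS) scale1r; dual_ring Fnorming.
- by rewrite /= scale1r addrC subrK.
- by rewrite /= !(linE lS) scale1r; dual_ring Fnorming.
exists s => y; move: (e y); rewrite phi1 /= => <-.
by rewrite addrC addKr.
Qed.

End EigenBoth.
End BothDirections.

(** * Action on rank-one operators *)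

Section RankOne.
Variable F : numFieldType.
Hypothesis Fnorming : norming F.
Variables (X Y : normedModType F) (A : set (X -> X)) (B : set (Y -> Y)).
Variables (phi : (X -> X) -> (Y -> Y)) (psi : (Y -> Y) -> (X -> X)).
Hypotheses (phiP : quadratic_bijection A B phi psi) (phi1 : phi id = id).
Implicit Types (S T : X -> X) (f : X -> F) (g : Y -> F) (x : X) (y : Y) (c d : F).

Let psiP := quadratic_bijection_sym phiP.
Let sA := q_stdA phiP.
Let sB := q_stdB phiP.
Let linB T (h : A T) := @std_lin _ _ _ sB _ (q_phiB phiP h).
Let phi0 := phi_zero Fnorming phiP.
Let phi_1 := phi_scal1 phi1.
Let psi_1 := phi_scal1 (psi1 phiP phi1).

(** Below the nonzero idempotent [phi P] lies a rank-one idempotent [Q']. Its preimage [Q] satisfies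
    [Q P = P Q = Q], so it is a multiple [k P] with [k^2 = k]; as [Q'] is nonzero, [k = 1] and
    [phi P = Q']. *)
Lemma rank_one_idempotent x0 f0 : dual f0 -> f0 x0 = 1 ->
  exists y0 g0, [/\ dual g0, g0 y0 = 1 & phi (rk x0 f0) = rk y0 g0].
Proof.
move=> f0d f00; set P := rk x0 f0.
have aP : A P by exact: std_rk.
have PP x : P (P x) = 1 *: P x.
  by rewrite /P /rk (dualE f0d) f00 mulr1 scale1r.
have P'P' := phi_eigen Fnorming phiP aP phi_1 PP.
have bP' := q_phiB phiP aP; have lP' := std_lin sB bP'.
have [y Py] : exists y, phi P y != 0.
  apply: contrapT => h; suff : f0 (P x0) = 0.
    by rewrite /P /rk f00 scale1r f00; apply/eqP/oner_neq0.
  rewrite (phi_eq0 Fnorming phiP aP) ?(dualE f0d)// => y.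
  by apply: contrapT => /eqP hy; apply: h; exists y.
set y0 := phi P y in Py; have Py0 : phi P y0 = y0 by rewrite /y0 P'P' scale1r.
have [g gd gy0] := dual_separates Fnorming Py.
have g0d : dual (g \o phi P) by apply: dual_comp => //; exact: std_bounded bP'.
exists y0, (g \o phi P); split => //; first by rewrite /= Py0.
set Q' := rk y0 _.
have bQ' : B Q' by exact: std_rk.
have Q'y0 : Q' y0 = y0 by rewrite /Q' /rk /= Py0 gy0 scale1r.
have Q'Q' z : Q' (Q' z) = 1 *: Q' z.
  by rewrite /Q' /rk (dualE g0d) /= Py0 gy0 mulr1 scale1r.
have P'Q' z : phi P (Q' z) = 1 *: Q' z.
  by rewrite /Q' /rk (linE lP') Py0 scale1r.
have Q'P' z : Q' (phi P z) = 1 *: Q' z.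
  by rewrite /Q' /rk /= P'P' !scale1r.
have := phi_eigen Fnorming psiP bQ' psi_1 Q'Q'.
have := phi_eigen_row Fnorming psiP bP' bQ' psi_1 P'P' P'Q'.
have := phi_eigen_col Fnorming psiP bP' bQ' psi_1 P'P' Q'P'.
rewrite (q_phiK phiP aP); set Q := psi Q' => QP PQ QQ.
have aQ : A Q by exact: q_psiA phiP _ _.
have lQ := std_lin sA aQ.
have QE x : Q x = f0 (Q x0) *: P x.
  rewrite -[LHS]scale1r -QP -[LHS]scale1r -PQ /P /rk !(linE lQ, dualE f0d).
  by rewrite scalerA mulrC.
have phiQ : phi Q = Q' by exact: q_psiK phiP _ _.
set k := f0 (Q x0) in QE.
have /eqP : k * k = k.
  have := congr1 f0 (QQ x0).
  by rewrite scale1r [in LHS]QE /P /rk !(dualE f0d) f00 mulr1.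
rewrite -[X in _ == X]mulr1 -subr_eq0 -mulrBr mulf_eq0 subr_eq0 => /orP[] /eqP k_.
  move: Py; rewrite -Q'y0 -phiQ (_ : Q = fun=> 0) ?phi0 ?eqxx//.
  by apply/funext => x; rewrite QE k_ scale0r.
by rewrite -phiQ; congr phi; apply/funext => x; rewrite QE k_ scale1r.
Qed.

(** * The semilinear map [alpha] and the field automorphism [tau] *)

Section Coordinates.
Variables (x0 : X) (f0 : X -> F) (y0 : Y) (g0 : Y -> F) (tau : F -> F).
Hypotheses (f0d : dual f0) (f00 : f0 x0 = 1) (g0d : dual g0) (g00 : g0 y0 = 1).
Hypothesis phiP0 : phi (rk x0 f0) = rk y0 g0.
Hypothesis tauP : forall c, phi (scal c) = scal (tau c).

Definition alpha x : Y := phi (rk x f0) y0.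
Definition beta f : Y -> F := g0 \o phi (rk x0 f).

Let aR x f (fd : dual f) : A (rk x f) := std_rk sA x fd.

Lemma beta_dual f : dual f -> dual (beta f).
Proof.
by move=> fd; apply: dual_comp => //; apply: std_bounded sB _ _;
  apply: q_phiB phiP _ _; exact: aR.
Qed.

Lemma idem0 x : rk x0 f0 (rk x0 f0 x) = 1 *: rk x0 f0 x.
Proof. by rewrite /rk (dualE f0d) f00 mulr1 scale1r. Qed.

(** Since (x f0)(x0 f0) = x f0, the image of x f0 factors through [phi (rk x0 f0) = rk y0 g0]. *)
Lemma phi_rk_f0 x y : phi (rk x f0) y = g0 y *: alpha x.
Proof.
rewrite -[LHS]scale1r.
rewrite -(phi_eigen_col Fnorming phiP (aR x0 f0d) (aR x f0d) phi_1 idem0); last first.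
  by move=> z; rewrite /rk (dualE f0d) f00 mulr1 scale1r.
by rewrite phiP0 [rk y0 g0 y]/rk (linE (linB (aR x f0d))).
Qed.

Lemma phi_rk_x0 f y : dual f -> phi (rk x0 f) y = beta f y *: y0.
Proof.
move=> fd; rewrite -[LHS]scale1r.
rewrite -(phi_eigen_row Fnorming phiP (aR x0 f0d) (aR x0 fd) phi_1 idem0).
  by rewrite phiP0.
by move=> z; rewrite /rk (dualE f0d) f00 mulr1 scale1r.
Qed.

Lemma alpha_eq0 x : alpha x = 0 -> x = 0.
Proof.
move=> ax; have h y : phi (rk x f0) y = 0 by rewrite phi_rk_f0 ax scaler0.
by have := phi_eq0 Fnorming phiP (aR x f0d) h x0; rewrite /rk f00 scale1r.
Qed.

Lemma alpha0 : alpha 0 = 0.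
Proof.
rewrite /alpha (_ : rk 0 f0 = fun=> 0) ?phi0//.
by apply/funext => x; rewrite /rk scaler0.
Qed.

Lemma alpha_x0 : alpha x0 = y0.
Proof. by rewrite /alpha phiP0 /rk g00 scale1r. Qed.

Lemma beta_eq0 f : dual f -> (forall y, beta f y = 0) -> forall x, f x = 0.
Proof.
move=> fd h x; have h' y : phi (rk x0 f) y = 0 by rewrite phi_rk_x0// h scale0r.
have := phi_eq0 Fnorming phiP (aR x0 fd) h' x; rewrite /rk => /eqP.
rewrite scaler_eq0 => /orP[/eqP //|/eqP e].
by move: f00; rewrite e (dualE f0d) => /esym/eqP; rewrite oner_eq0.
Qed.

(* The four rank-one blocks form a multiple of an idempotent, so their images
   satisfy one quadratic equation, which forces the coefficient of the fourth
   block to be 1. *)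
Lemma phi_rk x f y : dual f -> phi (rk x f) y = beta f y *: alpha x.
Proof.
move=> fd.
have [->|x_neq0] := eqVneq x 0.
  rewrite alpha0 scaler0 (_ : rk 0 f = fun=> 0) ?phi0//.
  by apply/funext => z; rewrite /rk scaler0.
have [f_eq0|] := pselect (forall z, f z = 0).
  have rk0 z : rk z f = fun=> 0 by apply/funext => u; rewrite /rk f_eq0 scale0r.
  by rewrite /beta !rk0 phi0 /= (dualE g0d) scale0r.
move=> f_neq0; set D := phi (rk x f); set b := beta f (alpha x).
have lD : lin_map D := linB (aR x fd).
(* The matrix is the column (x0, x) times the row (f0, f), so its coefficient is [f0 x0 + f x]. *)
have [z|z|z|z|s [p [e1 _ e3 e4]]] := phi_quad4 Fnorming phiP (s := 1 + f x)
  (aR x0 f0d) (aR x0 fd) (aR x f0d) (aR x fd).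
- by rewrite /rk !(dualE f0d, dualE fd) f00; dual_ring Fnorming.
- by rewrite /rk !(dualE f0d, dualE fd) f00; dual_ring Fnorming.
- by rewrite /rk !(dualE f0d, dualE fd) f00; dual_ring Fnorming.
- by rewrite /rk !(dualE f0d, dualE fd) f00; dual_ring Fnorming.
have bd := beta_dual fd.
have y0_neq0 : y0 != 0.
  by apply/eqP => e; move: g00; rewrite e (dualE g0d) => /esym/eqP; rewrite oner_eq0.
have a_neq0 : alpha x != 0 by apply: contra_neq x_neq0 => /alpha_eq0.
have {}e1 u : (g0 u * (1 + b)) *: y0 = (s * g0 u) *: y0 - p *: u.
  move: (e1 u); rewrite phiP0 !phi_rk_f0 phi_rk_x0// /rk !(dualE g0d, dualE bd) g00 -/b.
  by rewrite scalerA => <-; dual_ring Fnorming.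
have p0 : p = 0.
  have [k k_neq0 gk] := kernel_nontrivial (q_infY phiP) g0d.
  apply: (scale_vec_inj k_neq0); move: (e1 k); rewrite gk mul0r mulr0 !scale0r sub0r.
  by move=> /esym/eqP; rewrite oppr_eq0 => /eqP.
have sb : s = 1 + b.
  apply: (scale_vec_inj y0_neq0); move: (e1 y0).
  by rewrite g00 p0 scale0r subr0 mul1r mulr1.
have Da : D (alpha x) = b *: alpha x.
  move: (e3 y0); rewrite phiP0 /rk g00 scale1r phi_rk_f0 g00 scale1r -/D.
  by rewrite sb scalerDl scale1r => /addrI.
have {}e4 u : beta f u *: alpha x + D (D u) = s *: D u.
  move: (e4 u); rewrite p0 scale0r subr0 phi_rk_x0// phi_rk_f0 (dualE g0d) g00 mulr1.
  exact.
have hd := phi_eigen Fnorming phiP (aR x fd) (tauP (f x)).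
have {}hd u : D (D u) = tau (f x) *: D u.
  by apply: hd => z; rewrite /rk (dualE fd) scalerA mulrC.
have {}e4' u : (s - tau (f x)) *: D u = beta f u *: alpha x.
  by rewrite scalerBl -e4 -hd addrK.
have sd : s - tau (f x) != 0.
  apply/eqP => sd; apply: f_neq0; apply: (beta_eq0 fd) => u.
  by apply: (scale_vec_inj a_neq0); rewrite -e4' sd !scale0r.
have DE u : D u = ((s - tau (f x))^-1 * beta f u) *: alpha x.
  by rewrite -scalerA -e4' scalerA mulVf// scale1r.
(* The coefficient of [D] is read off at [alpha x], where [D] acts as [b]. This is uninformative for
   [b = 0], but then [D^2 = 0] and [s = 1], and the lower right entry suffices. *)
have [b0|b0] := eqVneq b 0.
  have DD0 : D (D y) = 0 by rewrite [D y]DE (linE lD) Da b0 scale0r scaler0.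
  by have := e4 y; rewrite DD0 sb b0 !addr0 scale1r.
rewrite DE; congr (_ *: _); suff -> : (s - tau (f x))^-1 = 1 by rewrite mul1r.
apply: (mulIf b0); rewrite mul1r; apply: (scale_vec_inj a_neq0).
by rewrite -Da DE.
Qed.

(** The relation (x f)^2 = f(x) (x f) is carried to one with coefficient [tau (f x)], to be compared
    with the square of alpha(x) beta(f). *)
Lemma beta_alpha x f : dual f -> beta f (alpha x) = tau (f x).
Proof.
move=> fd; have tau0 : tau 0 = 0.
  by apply/eqP; rewrite -(phi_scal_eq0 Fnorming phiP (tauP 0)).
have [->|x_neq0] := eqVneq x 0.
  by rewrite alpha0 (dualE (beta_dual fd)) (dualE fd) tau0.
have [f_eq0|f_neq0] := pselect (forall z, f z = 0).
  have rk0 z : rk z f = fun=> 0 by apply/funext => u; rewrite /rk f_eq0 scale0r.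
  by rewrite f_eq0 tau0 /beta rk0 phi0 /= (dualE g0d).
have [y by_] : exists y, beta f y != 0.
  apply: contrapT => h; apply: f_neq0; apply: (beta_eq0 fd) => y.
  by apply: contrapT => /eqP hy; apply: h; exists y.
have a_neq0 : alpha x != 0 by apply: contra_neq x_neq0 => /alpha_eq0.
have := phi_eigen Fnorming phiP (aR x fd) (tauP (f x)) _ y; rewrite !phi_rk// => h.
apply: (mulfI by_); apply: (scale_vec_inj a_neq0) => /=.
rewrite -[LHS]/((_ * _) *: _) -(dualE (beta_dual fd)) h ?scalerA 1?mulrC//.
by move=> z; rewrite /rk (dualE fd) scalerA mulrC.
Qed.

Lemma tau_inj : injective tau.
Proof.
move=> c d e; have [x x_neq0] := nonzero_vector (q_infX phiP).
apply: (scale_vec_inj x_neq0); rewrite /= -[c *: x]/(scal c x) -[d *: x]/(scal d x).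
congr (_ x); apply: (phi_inj phiP); [exact: std_scal | exact: std_scal |].
by rewrite !tauP e.
Qed.

Lemma tau_surj d : exists c, tau c = d.
Proof.
have [c hc] := phi_scal Fnorming psiP d; exists c.
have [y y_neq0] := nonzero_vector (q_infY phiP).
apply: (scale_vec_inj y_neq0); rewrite /= -[LHS]/(scal (tau c) y) -tauP -hc.
by rewrite (q_psiK phiP)//; exact: std_scal.
Qed.

Lemma tau1 : tau 1 = 1.
Proof.
have [y y_neq0] := nonzero_vector (q_infY phiP).
by apply: (scale_vec_inj y_neq0); rewrite /= -[LHS]/(scal (tau 1) y) -tauP phi_1.
Qed.

(** The operators (c x) f0 and x (c f0) coincide; their image is evaluated at [y0 = alpha x0], where
    the functional of c f0 takes the value [tau c]. *)
Lemma alphaZ c x : alpha (c *: x) = tau c *: alpha x.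
Proof.
have cd : dual (fun z => c * f0 z) by exact: dual_scale.
have := phi_rk x y0 cd; rewrite (_ : rk x _ = rk (c *: x) f0); last first.
  by apply/funext => z; rewrite /rk scalerA mulrC.
by rewrite -{2}alpha_x0 (beta_alpha _ cd) f00 mulr1.
Qed.

Lemma tauM c d : tau (c * d) = tau c * tau d.
Proof.
have y0_neq0 : y0 != 0.
  by apply/eqP => e; move: g00; rewrite e (dualE g0d) => /esym/eqP; rewrite oner_eq0.
by apply: (scale_vec_inj y0_neq0);
  rewrite /= -{1}alpha_x0 -alphaZ -scalerA !alphaZ scalerA alpha_x0.
Qed.

(** Before additivity is known, multiplicativity makes [tau (-1)] a square root of 1, and
    injectivity disposes of the value 1. *)
Lemma tauN1 : tau (-1) = -1.
Proof.
have : tau (-1) * tau (-1) = 1 by rewrite -tauM mulrNN mulr1 tau1.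
move=> /eqP; rewrite -expr2 sqrf_eq1 => /orP[] /eqP // e.
by have -> : -1 = 1 :> F by [apply: tau_inj; rewrite e tau1]; rewrite tau1.
Qed.

Lemma alphaN x : alpha (- x) = - alpha x.
Proof. by rewrite -scaleN1r alphaZ tauN1 scaleN1r. Qed.

(* The matrix [[- x (f T), x f], [T, (T x) f]] squares to zero when
   [f (T x) = -1]. *)
Lemma phi_alpha_neq0 T x : A T -> T x != 0 -> phi T (alpha x) = alpha (T x).
Proof.
move=> aT Tx; have lT := std_lin sA aT; have lT' := linB aT.
have [f fd fT] : exists2 f, dual f & f (T x) = -1.
  have [f fd f1] := dual_separates Fnorming Tx.
  by exists (fun z => -1 * f z); [exact: dual_scale | rewrite f1 mulr1].
have fTd : dual (f \o T) by apply: dual_comp => //; exact: std_bounded sA _ aT.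
have [z|z|z|z|s [p [_ e2 _ e4]]] := phi_quad4 Fnorming phiP (s := 0)
  (aR (- x) fTd) (aR x fd) aT (aR (T x) fd).
- by rewrite /rk /= !(linE lT, dualE fd) fT; dual_ring Fnorming.
- by rewrite /rk /= !(linE lT, dualE fd) fT; dual_ring Fnorming.
- by rewrite /rk /= !(linE lT, dualE fd); dual_ring Fnorming.
- by rewrite /rk /= !(linE lT, dualE fd) fT; dual_ring Fnorming.
have bd := beta_dual fd; have bTd := beta_dual fTd.
have bT : beta f (alpha (T x)) = -1 by rewrite (beta_alpha _ fd) fT tauN1.
have bTx : beta (f \o T) (alpha x) = -1 by rewrite (beta_alpha _ fTd) /= fT tauN1.
have a_neq0 : alpha x != 0.
  by apply: contra_neq Tx => /alpha_eq0 ->; rewrite (linE lT).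
(* The upper right entry at [alpha (T x)] gives [s = 0], the lower right one on the kernel of
   [beta f] gives [p = 0], and the lower right one at [alpha (T x)] is then the claim. *)
have s0 : s = 0.
  apply: (scale_vec_inj a_neq0); apply: oppr_inj.
  move: (e2 (alpha (T x))); rewrite !phi_rk// !(dualE bd, dualE bTd) bTx bT alphaN.
  by move=> E; transitivity (s *: (-1 *: alpha x));
    [|rewrite -E]; dual_ring Fnorming.
have p0 : p = 0.
  have [k k_neq0 bk] := kernel_nontrivial (q_infY phiP) bd.
  apply: (scale_vec_inj k_neq0); move: (e4 k); rewrite !phi_rk// bk.
  rewrite !scale0r (linE lT') (dualE bd) scale0r scaler0 addr0 sub0r.
  by move=> /esym/eqP; rewrite oppr_eq0 => /eqP.
move: (e4 (alpha (T x))); rewrite s0 p0 !phi_rk// !(dualE bd) bT !(linE lT').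
move=> E; apply: subr0_eq; apply: oppr_inj.
transitivity (-1 *: phi T (alpha x) + (-1 * -1) *: alpha (T x)).
  by dual_ring Fnorming.
by rewrite E; dual_ring Fnorming.
Qed.

(* Compare the value of [phi (1 - x f)] at [alpha z], where [f z = -1], given
   by the previous lemma and by [phi_compl]. *)
Lemma alphaD z x : alpha (z + x) = alpha z + alpha x.
Proof.
have [->|z_neq0] := eqVneq z 0; first by rewrite alpha0 !add0r.
have [/eqP|zx] := eqVneq (z + x) 0.
  by rewrite addr_eq0 => /eqP ->; rewrite alphaN !addNr alpha0.
have [f fd fz] : exists2 f, dual f & f (z) = -1.
  have [f fd f1] := dual_separates Fnorming z_neq0.
  by exists (fun z => -1 * f z); [exact: dual_scale | rewrite f1 mulr1].
have aT := std_sub sA (std_id sA) (aR x fd).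
have [s hs] := phi_compl Fnorming phiP phi1 (aR x fd).
have [w w_neq0 fw] := kernel_nontrivial (q_infX phiP) fd.
(* On the kernel of [f] the operator 1 - x f is the identity, so both formulas can be compared at
   [alpha w]. *)
have s1 : s = 1.
  have aw_neq0 : alpha w != 0 by apply: contra_neq w_neq0 => /alpha_eq0.
  apply: (scale_vec_inj aw_neq0); move: (hs (alpha w)).
  rewrite (phi_alpha_neq0 aT) /= /rk fw scale0r subr0// -/(rk _ _) phi_rk//.
  rewrite (beta_alpha _ fd) fw (_ : tau 0 = 0) ?scale0r ?subr0 ?scale1r//.
  by apply/eqP; rewrite -(phi_scal_eq0 Fnorming phiP (tauP 0)).
have Tz : z - rk x f z = z + x by rewrite /rk fz scaleN1r opprK.
move: (hs (alpha z)); rewrite (phi_alpha_neq0 aT) /= Tz// => ->.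
by rewrite phi_rk// (beta_alpha _ fd) fz tauN1 s1 scale1r scaleN1r opprK.
Qed.

Lemma tauD c d : tau (c + d) = tau c + tau d.
Proof.
have y0_neq0 : y0 != 0.
  by apply/eqP => e; move: g00; rewrite e (dualE g0d) => /esym/eqP; rewrite oner_eq0.
apply: (scale_vec_inj y0_neq0).
by rewrite /= -{1}alpha_x0 -alphaZ scalerDl alphaD !alphaZ alpha_x0 scalerDl.
Qed.

(** When [T x = 0], adding a vector [z] outside the kernel of [T] and subtracting the identity at
    [z] reduces to the nonzero case. *)
Lemma phi_alpha T x : A T -> phi T (alpha x) = alpha (T x).
Proof.
move=> aT; have lT := std_lin sA aT; have lT' := linB aT.
have [Tx|Tx] := eqVneq (T x) 0; last exact: phi_alpha_neq0.
have [[z Tz]|T0] := pselect (exists z, T z != 0).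
  have := phi_alpha_neq0 aT (x := x + z); rewrite (linE lT) Tx add0r alphaD (linE lT').
  move=> /(_ Tz); rewrite (phi_alpha_neq0 aT Tz) alpha0 -[RHS]add0r.
  exact: addIr.
have {}T0 : T = fun=> 0.
  by apply/funext => z; apply: contrapT => /eqP hz; apply: T0; exists z.
by rewrite T0 phi0 alpha0.
Qed.

Lemma alpha_inj : injective alpha.
Proof.
move=> x z e; apply: subr0_eq; apply: alpha_eq0.
by rewrite alphaD alphaN e subrr.
Qed.

(** The operator y g0 sends [y0 = alpha x0] to [y], and it is the image of some element of [A]. *)
Lemma alpha_surj y : exists x, alpha x = y.
Proof.
have bS := std_rk sB y g0d; exists (psi (rk y g0) x0).
rewrite -phi_alpha; last exact: q_psiA phiP _ _.
by rewrite (q_psiK phiP bS) alpha_x0 /rk g00 scale1r.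
Qed.

(** Let [S = psi (rk y0 g)]. From (y0 g0)(y0 g) = y0 g follows (x0 f0) S = S, so [S] is x0 times the
    functional [f0 \o S]; applying [phi] at [alpha x] compares this functional with [g]. *)
Lemma dual_pullback g : dual g ->
  exists2 f, dual f & forall x, g (alpha x) = tau (f x).
Proof.
move=> gd; have bS := std_rk sB y0 gd; have aS := q_psiA phiP bS.
exists (f0 \o psi (rk y0 g)); first by apply: dual_comp => //; exact: std_bounded sA _ aS.
move=> x; have y0_neq0 : y0 != 0.
  by apply/eqP => e; move: g00; rewrite e (dualE g0d) => /esym/eqP; rewrite oner_eq0.
apply: (scale_vec_inj y0_neq0) => /=.
transitivity (phi (psi (rk y0 g)) (alpha x)); first by rewrite (q_psiK phiP bS).
rewrite phi_alpha// -[X in _ = _ *: X]alpha_x0 -alphaZ.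
congr alpha; have := phi_eigen_row Fnorming psiP (q_phiB phiP (aR x0 f0d)) bS psi_1.
rewrite (q_phiK phiP (aR x0 f0d)) phiP0 => h.
rewrite -[LHS]scale1r -h => // z.
  by rewrite /rk (dualE g0d) g00 mulr1 scale1r.
by rewrite /rk (dualE g0d) g00 mulr1 scale1r.
Qed.

Lemma dual_pushforward f : dual f ->
  exists2 g, dual g & forall x, g (alpha x) = tau (f x).
Proof.
by move=> fd; exists (beta f); [exact: beta_dual | move=> x; exact: beta_alpha].
Qed.

End Coordinates.
End RankOne.

(** * Automatic continuity *)

Section GlidingHump.
Variable F : numFieldType.
Hypothesis Farch : forall x : F, 0 <= x -> exists n : nat, x <= n%:R.
Hypothesis Fnorming : norming F.

Lemma half_pow_small (e : F) : 0 < e -> exists n, 2 ^- n <= e.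
Proof.
move=> e0; have [n hn] : exists n : nat, e^-1 <= n%:R.
  by apply: Farch; rewrite invr_ge0 ltW.
exists n; rewrite invf_ple ?posrE ?exprn_gt0 ?ltr0n//.
by rewrite (le_trans hn)// -natrX ler_nat ltnW// ltn_expl.
Qed.

(** The order of [F] is only partial in the complex case, but norms and natural numbers are real,
    hence comparable. *)
Lemma normr_notle (V : normedModType F) (x : V) (n : nat) :
  ~ `|x| <= n%:R -> n%:R <= `|x|.
Proof. by move=> /negP; rewrite -real_ltNge ?normr_real ?realn// => /ltW. Qed.

Variables (X : completeNormedModType F) (Y : normedModType F).
Variables (alpha : X -> Y) (tau : F -> F).
Hypothesis alphaD : forall x z, alpha (x + z) = alpha x + alpha z.
Hypothesis pullback : forall g : Y -> F, dual g ->
  exists2 f : X -> F, dual f & forall x, g (alpha x) = tau (f x).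

Lemma cvg_geometric_steps (S : nat -> X) :
  (forall n, `|S n.+1 - S n| <= 2 ^- n) -> exists s : X, S n @[n --> \oo] --> s.
Proof.
(* The term [2 * 2 ^- (n + k)] bounds the steps still to come; keeping it makes the induction on [k]
   close. *)
move=> hS; have tail n k : `|S (n + k)%N - S n| + 2 * 2 ^- (n + k) <= 2 * 2 ^- n.
  elim: k => [|k IH]; first by rewrite addn0 subrr normr0 add0r.
  apply: le_trans IH; rewrite addnS.
  apply: (@le_trans _ _ ((2 ^- (n + k) + `|S (n + k)%N - S n|) + 2 * 2 ^- (n + k).+1)).
    rewrite lerD2r -(subrK (S (n + k)%N) (S _.+1)) -addrA.
    by rewrite (le_trans (ler_normD _ _))// lerD2r.
  rewrite [2 ^- _ + _]addrC -addrA lerD2l exprS invfM mulrA divff ?pnatr_eq0// mul1r.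
  by rewrite mulr_natl mulr2n.
have : cauchy (S n @[n --> \oo]).
  apply: cauchy_exP => e e0.
  have [N hN] : exists n, 2 ^- n <= e / 4 by apply: half_pow_small; rewrite divr_gt0.
  exists (S N); exists N => // n /= Nn.
  rewrite -ball_normE /ball_ /= distrC -(subnKC Nn).
  apply: (@le_lt_trans _ _ (2 * 2 ^- N)).
    apply: le_trans (tail N (n - N)%N); rewrite lerDl mulr_ge0// invr_ge0 exprn_ge0//.
  apply: (@le_lt_trans _ _ (2 * (e / 4))); first by rewrite ler_wpM2l.
  have -> : 2 * (e / 4) = e / 2 by field.
  by rewrite ltr_pdivrMr// ltr_pMr// ltr1n.
move=> /cauchy_cvg h; exists (lim (S n @[n --> \oo])); exact: h.
Qed.

(* Sum small vectors, each in the kernel of the functionals chosen so far, so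
   that the functional norming the image of a partial sum does not see the
   remaining terms. *)
Lemma gliding_hump :
  (forall (L : seq (X -> F)) (e : F) (n : nat), (forall f, f \in L -> dual f) ->
     0 < e -> exists x, [/\ `|x| <= e, forall f, f \in L -> f x = 0 &
                          n%:R <= `|alpha x|]) ->
  False.
Proof.
move=> hump.
pose good n (S : X) (L : seq (X -> F)) (xf : X * (X -> F)) :=
  [/\ `|xf.1| <= 2 ^- n, forall f, f \in L -> f xf.1 = 0, dual xf.2 &
    exists g : Y -> F, [/\ forall z, `|g z| <= `|z|, forall x, g (alpha x) = tau (xf.2 x)
      & n%:R <= `|g (alpha (S + xf.1))|]].
(* The condition on the list sits under the existential, so that [choice] yields a total function;
   bad lists get a dummy value. *)
have step (s : nat * (X * seq (X -> F))) : exists xf,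
    (forall f, f \in s.2.2 -> dual f) -> good s.1 s.2.1 s.2.2 xf.
  case: s => n [S L] /=; have [Ld|nLd] := pselect (forall f, f \in L -> dual f); last first.
    by exists (0, fun=> 0) => Ld; exfalso; exact: nLd.
  (* The margin [alpha S] keeps the image of the new partial sum above [n]. *)
  have [m hm] : exists m : nat, n%:R + `|alpha S| <= m%:R by apply: Farch; rewrite addr_ge0.
  have e0 : 0 < 2 ^- n :> F by rewrite invr_gt0 exprn_gt0.
  have [x [xe xL xm]] := hump L _ m Ld e0.
  have [g [gd gn gle]] := Fnorming (alpha (S + x)).
  have [f fd gf] := pullback gd.
  exists (x, f) => _; split=> //; exists g; split=> //=.
  rewrite gn normr_id alphaD -(lerD2r `|alpha S|).
  apply: (le_trans hm); apply: (le_trans xm).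
  rewrite -{1}(addKr (alpha S) (alpha x)) (le_trans (ler_normD _ _))//.
  by rewrite normrN addrC.
have [G hG] := choice step.
pose st := fix st n := if n is m.+1 then
  let xf := G (m, st m) in ((st m).1 + xf.1, xf.2 :: (st m).2) else (0 : X, [::] : seq
    (X -> F)).
have Ld n : forall f, f \in (st n).2 -> dual f.
  elim: n => [//|n IH] f; rewrite /= inE => /orP[/eqP ->|/IH//].
  by have [] := hG (n, st n) IH.
have hG' n : good n (st n).1 (st n).2 (G (n, st n)) by exact: (hG (n, st n) (Ld n)).
have [s hs] : exists s : X, (st n).1 @[n --> \oo] --> s.
  apply: cvg_geometric_steps => n.
  by rewrite /= addrAC subrr add0r; have [] := hG' n.
have [n hn] : exists n : nat, `|alpha s| + 1 <= n%:R by apply: Farch; rewrite addr_ge0.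
have [_ _ fd [g [gle gf ng]]] := hG' n.
set f := (G _).2 in fd gf.
have Lmono m : f \in (st (n.+1 + m)%N).2.
  by elim: m => [|m IH]; rewrite ?addn0 ?addnS /= inE ?eqxx// IH orbT.
(* From stage [n.+1] on, [f] is in the list and kills every new term. By continuity [f] takes the
   same value at the limit [s], so [alpha s] has norm at least [n]. *)
have fconst m : f (st (n.+1 + m)%N).1 = f (st n.+1).1.
  elim: m => [|m IH]; first by rewrite addn0.
  rewrite addnS /= (dualE fd); have [_ -> // _ _] := hG' (n.+1 + m)%N.
  by rewrite addr0.
have fs : f s = f (st n.+1).1.
  apply: (@cvg_unique _ (@norm_hausdorff F F) ((f \o (fun m => (st m).1)) @ \oo)).
    by apply: continuous_cvg hs; exact: fd.2.
  apply: cvg_near_cst; near=> m.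
  have nm : (n.+1 <= m)%N by near: m; exact: nbhs_infty_ge.
  by rewrite /= -(subnKC nm) fconst.
have : n%:R <= `|alpha s|.
  by rewrite (le_trans ng)// gf -[_ + _]/((st n.+1).1) -fs -gf.
move=> /(le_trans hn); rewrite gerDl => /(lt_le_trans ltr01).
by rewrite ltxx.
Unshelve. all: by end_near. Qed.

Hypothesis alphaZ : forall c x, alpha (c *: x) = tau c *: alpha x.

(** Infinite dimension provides a nonzero [y] in the common kernel; if [tau] were unbounded near 0,
    suitable small multiples [t *: y] would be humps. *)
Lemma semilinear_scalar_bounded :
  infinite_dim X -> (forall x, alpha x = 0 -> x = 0) ->
  exists2 d : F, 0 < d & exists n : nat, forall t, `|t| <= d -> `|tau t| <= n%:R.
Proof.
move=> Xinf a0; apply: contrapT => unb; apply: gliding_hump => L e n Ld e0.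
have [y y0 yL] := kernels_nontrivial Xinf Ld.
have ay : 0 < `|alpha y| by rewrite normr_gt0; apply: contra_neq y0 => /a0.
have ny : 0 < `|y| by rewrite normr_gt0.
have [m hm] : exists m : nat, n%:R / `|alpha y| <= m%:R.
  by apply: Farch; rewrite divr_ge0.
have [t [td tm]] : exists t, `|t| <= e / `|y| /\ m%:R <= `|tau t|.
  apply: contrapT => h; apply: unb; exists (e / `|y|); first by rewrite divr_gt0.
  exists m => t td; apply: contrapT => ht; apply: h; exists t; split=> //.
  exact: (@normr_notle F^o).
exists (t *: y); split.
- by rewrite normrZ -ler_pdivlMr.
- by move=> f fL; rewrite (dualE (Ld _ fL)) yL// mulr0.
- by rewrite alphaZ normrZ -ler_pdivrMr// (le_trans hm).
Qed.

Hypothesis tau_norm : forall t, `|tau t| = `|t|.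

Lemma small_functional (f : X -> F) (e : F) : dual f -> 0 < e ->
  exists2 d, 0 < d & forall x, `|x| <= d -> `|f x| <= e.
Proof.
move=> fd e0; have /cvgrPdist_le/(_ _ e0) := fd.2 0.
rewrite (dual0 fd) => /nbhs_ballP[d /= d0 hd].
exists (d / 2); first by rewrite divr_gt0.
move=> x xd; rewrite -normrN -sub0r; apply: hd; rewrite -ball_normE /= sub0r normrN.
by rewrite (le_lt_trans xd)// ltr_pdivrMr// ltr_pMr// ltr1n.
Qed.

(** If [alpha] were unbounded, humps would exist in all finite intersections of kernels, by
    induction on the list: a hump [x] for the tail is corrected to [x - f x *: v], where [f v = 1]
    and the tail vanishes at [v]. *)
Lemma semilinear_bounded :
  exists2 d : F, 0 < d & exists n : nat, forall x, `|x| <= d -> `|alpha x| <= n%:R.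
Proof.
apply: contrapT => unb; apply: gliding_hump => L.
elim: L => [|f L IH] e n Ld e0.
  apply: contrapT => h; apply: unb; exists e => //; exists n => x xe.
  by apply: contrapT => hx; apply: h; exists x; split => //; exact: normr_notle.
have fd : dual f by apply: Ld; rewrite mem_head.
have {Ld} Ld g : g \in L -> dual g by move=> gL; apply: Ld; rewrite in_cons gL orbT.
have [[u [uL fu]]|nfu] :=
  pselect (exists u, (forall g, g \in L -> g u = 0) /\ f u != 0); last first.
  have [x [xe xL xn]] := IH e n Ld e0; exists x; split => // g.
  rewrite inE => /orP[/eqP ->|/xL//]; apply: contrapT => /eqP fx.
  by apply: nfu; exists x.
have [v fv vL] : exists2 v, f v = 1 & forall g, g \in L -> g v = 0.
  exists ((f u)^-1 *: u) => [|g gL]; first by rewrite (dualE fd) mulVf.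
  by rewrite (dualE (Ld _ gL)) (uL _ gL) mulr0.
have v1 : 0 < 1 + `|v| by rewrite ltr_wpDr.
(* With [f x] at most [eta] in norm, the correction [f x *: v] has norm at most [e / 2], and the
   choice of [m] absorbs its image. *)
pose eta := e / 2 / (1 + `|v|).
have eta0 : 0 < eta by rewrite !divr_gt0.
have [d d0 hd] := small_functional fd eta0.
have [m hm] : exists m : nat, n%:R + eta * `|alpha v| <= m%:R.
  by apply: Farch; rewrite addr_ge0// mulr_ge0// ltW.
have dmin0 : 0 < Num.min d (e / 2) by rewrite /Num.min; case: ifP => // _; rewrite divr_gt0.
have cmp : (d >=< e / 2)%O by apply: real_comparable; apply: gtr0_real => //;
  rewrite divr_gt0.
have [x [xe xL xm]] := IH _ m Ld dmin0.
have [xd xe2] : `|x| <= d /\ `|x| <= e / 2.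
  by move: xe; rewrite comparable_le_min// => /andP[].
have fx := hd _ xd.
exists (x - f x *: v); split.
- rewrite (le_trans (ler_normB _ _))// normrZ [leRHS](splitr e) lerD//.
  apply: (le_trans (y := eta * (1 + `|v|))); last by rewrite /eta mulfVK// gt_eqF.
  by apply: ler_pM => //; rewrite lerDr.
- move=> g; rewrite inE => /orP[/eqP ->|gL]; first by rewrite !(dualE fd) fv mulr1 subrr.
  by rewrite !(dualE (Ld _ gL)) (xL _ gL) (vL _ gL) mulr0 subrr.
- have -> : alpha (x - f x *: v) = alpha x - alpha (f x *: v).
    by apply/esym/eqP; rewrite subr_eq -alphaD subrK.
  rewrite alphaZ -(lerD2r (eta * `|alpha v|)); apply: le_trans hm _.
  apply: le_trans xm _.
  rewrite -[X in `|X| <= _](subrK (tau (f x) *: alpha v)) (le_trans (ler_normD _ _))//.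
  by rewrite lerD2l normrZ tau_norm ler_wpM2r.
Qed.

Lemma semilinear_continuous : continuous alpha.
Proof.
have [d d0 [n hn]] := semilinear_bounded.
have a0 : alpha 0 = 0 by apply: (addrI (alpha 0)); rewrite -alphaD !addr0.
move=> x; apply/cvgrPdist_le => e e0.
have n1 : 0 < n.+1%:R :> F by rewrite ltr0n.
(* The denominator is [n.+1] since [n] may be 0. *)
pose c := e / n.+1%:R; have c0 : 0 < c by rewrite divr_gt0.
near=> z.
have xz : `|x - z| <= c * d.
  by near: z; apply: cvgr_dist_le; [exact: cvg_id | rewrite mulr_gt0].
have -> : alpha x - alpha z = alpha (c *: (c^-1 *: (x - z))).
  by rewrite scalerA divff ?gt_eqF// scale1r; apply/eqP; rewrite subr_eq -alphaD subrK.
rewrite alphaZ normrZ tau_norm (gtr0_norm c0).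
apply: (@le_trans _ _ (c * n%:R)).
  rewrite ler_pM2l//; apply: hn.
  by rewrite normrZ gtr0_norm ?invr_gt0// mulrC ler_pdivrMr// mulrC.
by rewrite /c mulrAC ler_pdivrMr// ler_pM2l// ler_nat.
Unshelve. all: by end_near. Qed.

End GlidingHump.

(** * The Hahn-Banach theorem *)

Section HahnBanach.
Variables (R : realType) (K : nzRingType) (iota : {rmorphism R -> K}) (V : lmodType K).
Implicit Types (p q : V -> R) (x y z : V) (c t : R).

(** Homogeneity is asked along [iota], so that a complex space is treated as a real one. The
    inequality for [c] and for its inverse gives equality. *)
Definition sublinear p :=
  (forall x y, p (x + y) <= p x + p y) /\
  (forall c x, 0 < c -> p (iota c *: x) <= c * p x).

Lemma sublinear0 p : sublinear p -> p 0 = 0.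
Proof.
move=> [_ ph]; have h2 := ph 2 0 (ltr0Sn _ 1).
have h2' : p (iota 2^-1 *: 0) <= 2^-1 * p 0 by apply: ph; rewrite invr_gt0.
rewrite !scaler0 in h2 h2'; lra.
Qed.

Lemma sublinear_homo p c x : sublinear p -> 0 < c -> p (iota c *: x) = c * p x.
Proof.
move=> [_ ph] c0; apply/eqP; rewrite eq_le ph//= -ler_pdivlMl//.
have := ph c^-1 (iota c *: x); rewrite scalerA -rmorphM mulVf ?gt_eqF//.
by rewrite rmorph1 scale1r; apply; rewrite invr_gt0.
Qed.

Lemma sublinear_opp p x : sublinear p -> - p (- x) <= p x.
Proof.
move=> ps; have := ps.1 x (- x); rewrite subrr (sublinear0 ps); lra.
Qed.

(** This serves both for lowering a functional in one direction and for bounding chains in Zorn's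
    lemma; [m] keeps the infimum finite. *)
Lemma inf_sublinear (I : Type) (i0 : I) (s : I -> V -> R) (m : V -> R) :
  (forall i x, m x <= s i x) ->
  (forall i j x y, exists k, s k (x + y) <= s i x + s j y) ->
  (forall i c x, 0 < c -> exists k, s k (iota c *: x) <= c * s i x) ->
  let q x := inf [set s i x | i in [set: I]] in
  sublinear q /\ forall i x, q x <= s i x.
Proof.
move=> hm sD sZ q.
have q_le i x : q x <= s i x.
  by apply: ge_inf; [exists (m x) => _ [j _ <-]; exact: hm | exists i].
have q_ge x r : (forall i, r <= s i x) -> r <= q x.
  by move=> h; apply: lb_le_inf; [exists (s i0 x), i0 | move=> _ [j _ <-]].
split=> //; split=> [x y|c x c0].
  rewrite -lerBlDr; apply: (q_ge _) => i; rewrite lerBlDr -lerBlDl; apply: q_ge => j.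
  by rewrite lerBlDl; have [k hk] := sD i j x y; exact: le_trans (q_le k _) hk.
rewrite -ler_pdivrMl//; apply: (q_ge _) => i; rewrite ler_pdivrMl//.
by have [k hk] := sZ i c x c0; exact: le_trans (q_le k _) hk.
Qed.

(** [q] is the infimum over [t] of p(x + |t| y) - |t| p(y), which is bounded below by -p(-x). The
    two inequalities come from [t = 0] and [t = 1]. *)
Lemma sublinear_lower p y : sublinear p -> exists q, [/\ sublinear q,
  forall x, q x <= p x & forall x, q x <= p (x + y) - p y].
Proof.
move=> ps; pose s t x := p (x + iota `|t| *: y) - `|t| * p y.
have p_t t : p (iota `|t| *: y) = `|t| * p y.
  have [->|t0] := eqVneq t 0; last by rewrite sublinear_homo// normr_gt0.
  by rewrite normr0 rmorph0 scale0r mul0r sublinear0.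
have [||| qs q_le] := @inf_sublinear R 0 s (fun x => - p (- x)).
- move=> t x; rewrite /s -p_t.
  by have := ps.1 (x + iota `|t| *: y) (- x); rewrite [x + _]addrC addrK; lra.
- move=> t u x z; exists (`|t| + `|u|); rewrite /s ger0_norm ?addr_ge0//.
  have := ps.1 (x + iota `|t| *: y) (z + iota `|u| *: y).
  by rewrite addrACA -scalerDl -rmorphD; lra.
- move=> t c x c0; exists (c * `|t|); rewrite /s ger0_norm ?mulr_ge0 ?(ltW c0)//.
  have := ps.2 c (x + iota `|t| *: y) c0; rewrite scalerDr scalerA -rmorphM.
  by lra.
eexists; split; [exact: qs | |].
  move=> x; apply: le_trans (q_le 0 x) _.
  by rewrite /s normr0 rmorph0 scale0r addr0 mul0r subr0.
by move=> x; have := q_le 1 x; rewrite /s normr1 rmorph1 scale1r mul1r.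
Qed.

(* A minimal sublinear functional below [p] is linear, since [sublinear_lower]
   cannot decrease it. *)
Lemma minimal_sublinear p : sublinear p -> exists f : V -> R,
  [/\ forall x y, f (x + y) = f x + f y, forall c x, f (iota c *: x) = c * f x
    & forall x, f x <= p x].
Proof.
move=> ps.
pose T := {q : V -> R | sublinear q /\ forall x, q x <= p x}.
(* The order is reversed, so that a maximal element is a minimal functional. *)
pose le (q1 q2 : T) := `[< forall x, sval q2 x <= sval q1 x >].
have p_in : sublinear p /\ forall x, p x <= p x by [].
have [||A Atot|q qmin] := @ZL_preorder T (exist _ p p_in) le.
- by move=> q; apply/asboolP.
- by move=> q1 q2 q3 /asboolP h1 /asboolP h2; apply/asboolP => x; exact: le_trans (h1 x).
- have [[q0 Aq0]|A0] := pselect (exists q : T, A q); last first.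
    by exists (exist _ p p_in) => s As; exfalso; apply: A0; exists s.
  pose I := {q : T | A q}; pose s (i : I) := sval (sval i).
  have [||| qs q_le] := @inf_sublinear I (exist _ q0 Aq0) s (fun x => - p (- x)).
  + move=> [[q [qs qp]] Aq] x /=; apply: le_trans (sublinear_opp x qs).
    by rewrite lerN2.
  + move=> [q1 A1] [q2 A2] x y; rewrite /s /=.
    have [/asboolP h|/asboolP h] := Atot _ _ A1 A2.
      exists (exist _ q2 A2) => /=; apply: le_trans ((svalP q2).1.1 x y) _.
      by rewrite lerD2r.
    exists (exist _ q1 A1) => /=; apply: le_trans ((svalP q1).1.1 x y) _.
    by rewrite lerD2l.
  + by move=> i c x c0; exists i; apply: (svalP (sval i)).1.2.
  unshelve eexists.
    exists (fun x => inf [set s i x | i in [set: I]]); split=> // x.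
    exact: le_trans (q_le (exist _ q0 Aq0) x) ((svalP q0).2 x).
  by move=> q Aq; apply/asboolP => x /=; exact: (q_le (exist _ q Aq) x).
have [qs qp] := svalP q.
have qD x y : sval q (x + y) = sval q x + sval q y.
  apply/eqP; rewrite eq_le qs.1 /=.
  have [r [rs rq ry]] := sublinear_lower y qs.
  have rT : sublinear r /\ forall x, r x <= p x.
    by split=> // z; exact: le_trans (rq z) (qp z).
  have /asboolP/(_ x) /= : le (exist _ r rT) q by apply: qmin; apply/asboolP.
  by have := ry x; lra.
exists (sval q); split=> // c x.
have qN z : sval q (- z) = - sval q z.
  by apply/eqP; rewrite -addr_eq0 -qD addNr sublinear0.
have [c0|c0|->] := ltgtP c 0.
- rewrite -[c]opprK rmorphN scaleNr qN sublinear_homo ?oppr_gt0//; ring.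
- exact: sublinear_homo.
- by rewrite rmorph0 scale0r mul0r sublinear0.
Qed.

(** Lowering [p] in the direction [x0] before minimising gives f(-x0) <= p(0) - p(x0), which is the
    missing inequality at [x0]. *)
Lemma hahn_banach_real p x0 : sublinear p -> exists f : V -> R,
  [/\ forall x y, f (x + y) = f x + f y, forall c x, f (iota c *: x) = c * f x,
      forall x, f x <= p x & f x0 = p x0].
Proof.
move=> ps; have [q [qs qp qx0]] := sublinear_lower x0 ps.
have [f [fD fZ fq]] := minimal_sublinear qs.
exists f; split=> // [x|]; first exact: le_trans (fq x) (qp x).
apply/eqP; rewrite eq_le (le_trans (fq _) (qp _))//=.
have := le_trans (fq (- x0)) (qx0 (- x0)); rewrite addNr (sublinear0 ps).
have -> : f (- x0) = - f x0 by have := fZ (-1) x0; rewrite rmorphN1 scaleN1r mulN1r.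
lra.
Qed.

End HahnBanach.

(** * Scalar fields *)

Lemma contraction_dual (F : numFieldType) (X : normedModType F) (f : X -> F) :
  (forall a x y, f (a *: x + y) = a * f x + f y) -> (forall z, `|f z| <= `|z|) ->
  dual f.
Proof.
move=> fl f1; split=> // x; apply/cvgrPdist_le => e e0; near=> z.
have -> : f x - f z = f (x - z).
  by rewrite addrC -[in LHS]mulN1r -fl scaleN1r addrC.
apply: le_trans (f1 _) _; near: z.
by apply: cvgr_dist_le; [exact: cvg_id | exact: e0].
Unshelve. all: by end_near. Qed.

Lemma norming_real (R : realType) : norming R.
Proof.
move=> X x0; pose p (x : X) : R := `|x|.
have ps : @sublinear R R idfun X p.
  split=> [x y|c x c0]; first exact: ler_normD.
  by rewrite /p normrZ gtr0_norm.
have [f [fD fZ fp fx0]] := hahn_banach_real x0 ps.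
have f1 z : `|f z| <= `|z|.
  rewrite ler_norml fp andbT lerNl -mulN1r -(fZ (-1)) (le_trans (fp _))// /p /=.
  by rewrite scaleN1r normrN.
exists f; split=> //; apply: contraction_dual => // a x y.
by rewrite fD (fZ a).
Qed.

Lemma norm_real_complex (R : realType) (x : R) : `|x%:C%C| = `|x|%:C%C :> R[i].
Proof. by rewrite normc_def /= expr0n addr0 sqrtr_sqr. Qed.

(** A real-linear [u] dominated by the norm and norming [x0] is completed to the complex-linear
    functional u(z) - i u(i z). *)
Lemma norming_complex (R : realType) : norming R[i].
Proof.
move=> X x0; pose p (x : X) : R := complex.Re `|x|.
have pE x : (p x)%:C%C = `|x| by apply: RRe_real; exact: normr_real.
have ps : @sublinear R R[i] (real_complex R) X p.
  split=> [x y|c x c0]; rewrite -lecR ?rmorphD ?rmorphM /= !pE; first exact: ler_normD.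
  by rewrite normrZ norm_real_complex gtr0_norm.
have [u [uD uZ up ux0]] := hahn_banach_real x0 ps.
pose f (z : X) : R[i] := (u z +i* - u ('i%C *: z))%C.
have uC (a : R[i]) x : u (a *: x) = complex.Re a * u x + complex.Im a * u ('i%C *: x).
  rewrite -!uZ -uD scalerA -scalerDl; congr (u (_ *: _)).
  by rewrite {1}[a]complexE [_ * 'i%C]mulrC.
have fl (a : R[i]) x y : f (a *: x + y) = a * f x + f y.
  rewrite /f scalerDr !uD scalerA (uC a x) (uC ('i%C * a) x); case: a => a1 a2.
  by apply/eqP; rewrite eq_complex /=; apply/andP; split; apply/eqP; ring.
have fZ (a : R[i]) x : f (a *: x) = a * f x.
  have f0 : f 0 = 0.
    by have := fl 1 0 0; rewrite scale1r addr0 mul1r => /esym/(canRL (addrK _));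
      rewrite subrr.
  by rewrite -[a *: x]addr0 fl f0 addr0.
have f1 z : `|f z| <= `|z|.
  have [->|w0] := eqVneq (f z) 0; first by rewrite normr0.
  (* Rotating [z] by a scalar of modulus 1 makes the value of [f] real, hence equal to that of
     [u]. *)
  have := up ((`|f z| / f z) *: z); rewrite -lecR pE normrZ normrM normfV normr_id.
  rewrite divff ?normr_eq0// mul1r; apply: le_trans; rewrite -[u _]/(complex.Re (f _)) fZ.
  by rewrite divfK// RRe_real// normr_real.
exists f; split => //; first exact: contraction_dual.
have r_x0 : (u x0)%:C%C = `|x0| by rewrite ux0 pE.
(* The real part of [f x0] already has the full norm of [x0], so the imaginary part vanishes. *)
have := f1 x0; rewrite -(ler_pXn2r (n := 2)) ?nnegrE//.
rewrite -add_Re2_Im2 -r_x0 -rmorphXn lecR /= => h.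
have im0 : u ('i%C *: x0) = 0.
  by apply/eqP; rewrite -sqrf_eq0 -sqrrN eq_le sqr_ge0 andbT; move: h; rewrite gerDl.
by rewrite /f im0 oppr0.
Qed.

Lemma arch_real (R : realType) (x : R) : 0 <= x -> exists n : nat, x <= n%:R.
Proof.
by move=> x0; exists (Num.truncn x).+1; rewrite ltW// truncnS_gt.
Qed.

Lemma arch_complex (R : realType) (x : R[i]) : 0 <= x -> exists n : nat, x <= n%:R.
Proof.
move=> x0; have xE : (complex.Re x)%:C%C = x by apply: RRe_real; exact: ger0_real.
have [n hn] : exists n : nat, complex.Re x <= n%:R by apply: arch_real; rewrite -ler0c xE.
by exists n; rewrite -xE -(rmorph_nat (real_complex R)) lecR.
Qed.

(** * Additive maps of the scalar field that are bounded near 0 *)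

Section BoundedAutomorphisms.
Variable F : numFieldType.
Hypothesis Farch : forall x : F, 0 <= x -> exists n : nat, x <= n%:R.
Variable tau : F -> F.
Hypothesis tauD : forall s t, tau (s + t) = tau s + tau t.
Hypothesis tau1 : tau 1 = 1.
Hypothesis tau_bounded : exists2 d : F, 0 < d &
  exists n : nat, forall t, `|t| <= d -> `|tau t| <= n%:R.

Let tau0 : tau 0 = 0.
Proof. by apply: (addrI (tau 0)); rewrite -tauD !addr0. Qed.

Let tauN t : tau (- t) = - tau t.
Proof. by apply/eqP; rewrite -addr_eq0 -tauD addNr tau0. Qed.

Let tauMn t n : tau (t *+ n) = tau t *+ n.
Proof. by elim: n => [|n IH]; rewrite ?mulr0n// !mulrS tauD IH. Qed.

Let tau_int (m : int) : tau m%:~R = m%:~R.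
Proof.
by case: m => n; rewrite ?NegzE ?rmorphN /= ?tauN -pmulrn tauMn tau1.
Qed.

Lemma tau_bounded_unit_ball : exists n : nat, forall t, `|t| <= 1 -> `|tau t| <= n%:R.
Proof.
have [d d0 [n hn]] := tau_bounded.
have [N hN] : exists N : nat, d^-1 <= N%:R by apply: Farch; rewrite invr_ge0 ltW.
have N0 : 0 < N%:R :> F by rewrite (lt_le_trans _ hN)// invr_gt0.
exists (N * n)%N => t t1.
have -> : t = (t / N%:R) *+ N by rewrite -mulr_natr divfK// gt_eqF.
rewrite tauMn normrMn -[leLHS]mulr_natl natrM ler_pM2l//; apply: hn.
rewrite normrM normfV (gtr0_norm N0) ler_pdivrMr//.
by rewrite (le_trans t1)// -ler_pdivrMl// mulr1.
Qed.

(** With [m] an integer close to n t, n (tau t - t) = tau (n t - m) - (n t - m) is bounded by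
    [K + 1] for every [n], which contradicts the archimedean property unless [tau t = t]. *)
Lemma tau_fixes t :
  (forall n : nat, exists m : int, `|t *+ n - m%:~R| <= 1) -> tau t = t.
Proof.
move=> approx; have [K hK] := tau_bounded_unit_ball.
apply/eqP; rewrite -subr_eq0 -normr_eq0; apply/negP => /negP e0.
have {}e0 : 0 < `|tau t - t| by rewrite lt_def e0 normr_ge0.
have [n hn] : exists n : nat, (K.+2)%:R / `|tau t - t| <= n%:R.
  by apply: Farch; rewrite divr_ge0// ltW.
move: hn; rewrite ler_pdivrMr// mulr_natl -normrMn mulrnBl.
have [m hm] := approx n; apply/negP; rewrite -real_ltNge ?normr_real ?realn//.
apply: (@le_lt_trans _ _ K.+1%:R); last by rewrite ltr_nat.
have -> : tau t *+ n - t *+ n = tau (t *+ n - m%:~R) - (t *+ n - m%:~R).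
  by rewrite tauD tauN tau_int tauMn; ring.
by rewrite (le_trans (ler_normB _ _))// -natr1 lerD// hK.
Qed.

End BoundedAutomorphisms.

Lemma real_approx (R : realType) (x : R) (n : nat) : exists m : int, `|x *+ n - m%:~R| <= 1.
Proof.
exists (Num.floor (x *+ n)).
by rewrite ger0_norm ?subr_ge0 ?ge_floor// lerBlDl ltW// -intrD1 floorD1_gt.
Qed.

(** Real numbers are fixed because they have integer approximations, and the image of [i] is a
    square root of -1, so it is [i] or its opposite. *)
Lemma bounded_automorphism_complex (R : realType) (tau : R[i] -> R[i]) :
  (forall s t, tau (s + t) = tau s + tau t) ->
  (forall s t, tau (s * t) = tau s * tau t) -> tau 1 = 1 ->
  (exists2 d : R[i], 0 < d & exists n : nat, forall t, `|t| <= d -> `|tau t| <= n%:R) ->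
  (forall t, tau t = t) \/ (forall t, tau t = Num.conj_op t).
Proof.
move=> tauD tauM tau1 taub.
have tauR x : tau x%:C%C = x%:C%C.
  apply: (tau_fixes (@arch_complex R) tauD tau1 taub) => n.
  have [m hm] := real_approx x n; exists m.
  rewrite -(rmorph_int (real_complex R)) -rmorphMn -rmorphB norm_real_complex.
  by rewrite -(rmorph1 (real_complex R)) lecR.
have : tau 'i%C * tau 'i%C = -1.
  rewrite -tauM -expr2 sqr_i; have := tauR (-1); rewrite rmorphN1; exact.
rewrite -expr2 -(@sqr_i R) => /eqP; rewrite eqf_sqr => /orP[]/eqP ti; [left|right] => t;
  rewrite {1}[t]complexE tauD tauM !tauR ti.
  by rewrite -complexE.
rewrite -[RHS]/(conjc t); case: t => x y /=.
by apply/eqP; rewrite eq_complex /=; apply/andP; split; apply/eqP; ring.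
Qed.

(** * The equivalence *)

Section Transfer.
Variable F : numFieldType.

(* The roots [a], [b] of a quadratic [T] become [lam * tau a], [lam * tau b]. *)
Lemma quadratic_transfer (X Y : normedModType F) (tau sig : F -> F)
    (U : X -> Y) (V : Y -> X) (lam : F) n (T : 'M[X -> X]_n) :
  (forall x z, U (x + z) = U x + U z) -> (forall c x, U (c *: x) = tau c *: U x) ->
  cancel sig tau -> cancel U V -> cancel V U -> (forall i j, lin_map (T i j)) ->
  quadratic_mx T ->
  quadratic_mx (\matrix_(i, j) (fun y => lam *: U (T i j (V y)))).
Proof.
move=> UD UZ tauK UK VK lT [a [b q]]; exists (lam * tau a), (lam * tau b) => v.
have U0 : U 0 = 0 by apply: (addrI (U 0)); rewrite -UD !addr0.
have UB x z : U (x - z) = U x - U z by apply/esym/eqP; rewrite subr_eq -UD subrK.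
have Usum (f : 'I_n -> X) : \sum_(j < n) U (f j) = U (\sum_(j < n) f j).
  by apply/esym; apply: (big_morph U UD U0).
set T' := \matrix_(i, j) _.
have T'E u : mx_apply T' u = fun i => lam *: U (mx_apply T (V \o u) i).
  apply/funext => i; rewrite /mx_apply -Usum scaler_sumr.
  by apply: eq_bigr => j _; rewrite mxE.
pose x := V \o v; pose w i := mx_apply T x i - b *: x i.
have wE i : mx_apply T' v i - (lam * tau b) *: v i = lam *: U (w i).
  rewrite T'E /w UB UZ scalerBr scalerA.
  by rewrite /x /= VK.
rewrite /= (funext wE); apply/funext => i; rewrite T'E wE.
(* Pulling [lam] through [V] turns it into [sig lam]; the outer [U] turns it back into [lam]. *)
have -> : V \o (fun i => lam *: U (w i)) = fun i => sig lam *: w i.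
  by apply/funext => j; rewrite /= -[in X in V X](tauK lam) -UZ UK.
have -> : mx_apply T (fun j => sig lam *: w j) i = sig lam *: mx_apply T w i.
  by rewrite /mx_apply scaler_sumr; apply: eq_bigr => j _; rewrite (linE (lT i j)).
have /(congr1 (@^~ i))/= /subr0_eq := q x; rewrite -/w => ->.
rewrite !UZ tauK !scalerA; apply/eqP; rewrite subr_eq0; apply/eqP.
by congr (_ *: _); ring.
Qed.

Variables (cj : F -> F).
Hypothesis cj1 : cj 1 = 1.
Hypothesis cjK : involutive cj.

(** Injectivity of [phi] makes [lam] nonzero, so that [T] is recovered as tau(lam^-1) V phi(T) U and
    the transfer applies in both directions. *)
Lemma completely_quadratic_preserving (X Y : normedModType F) (A : set (X -> X))
    (B : set (Y -> Y)) (phi : (X -> X) -> (Y -> Y)) (U : X -> Y) (V : Y -> X) lam :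
  infinite_dim X -> standard_op_alg A -> standard_op_alg B -> bij_between A B phi ->
  lin_map U \/ conjlin_map cj U -> cancel U V -> cancel V U ->
  (forall T, A T -> phi T = (fun y => lam *: U (T (V y)))) ->
  forall n, n_quad_pres A phi n.
Proof.
move=> Xinf sA sB [phiB phiI _] Ulin UK VK phiE n T AT.
have lT i j : lin_map (T i j) by exact: std_lin sA _ (AT i j).
have lphiT i j : lin_map (phi (T i j)) by exact: std_lin sB _ (phiB _ (AT i j)).
have [tau [tauK tau1 U1]] : exists tau, [/\ involutive tau, tau 1 = 1 &
    forall c x z, U (c *: x + z) = tau c *: U x + U z].
  by case: Ulin => h; [exists id | exists cj].
have UD x z : U (x + z) = U x + U z by rewrite -{1}[x]scale1r U1 tau1 scale1r.
have U0 : U 0 = 0 by apply: (addrI (U 0)); rewrite -UD !addr0.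
have UZ c x : U (c *: x) = tau c *: U x by rewrite -[c *: x]addr0 U1 U0 addr0.
have VD y z : V (y + z) = V y + V z by rewrite -{1}[y]VK -{1}[z]VK -UD UK.
have VZ c y : V (c *: y) = tau c *: V y.
  by rewrite -{1}[y]VK -{1}[c]tauK -UZ UK.
have lam0 : lam != 0.
  apply/eqP => l0; have [x x0] := nonzero_vector Xinf.
  have Aid := std_id sA; have A0 := std_scal sA 0.
  have : id = scal 0 :> (X -> X).
    by apply: phiI => //; rewrite !phiE// l0; apply/funext => y; rewrite !scale0r.
  by move=> /(congr1 (@^~ x)); rewrite /scal scale0r => /eqP; rewrite (negbTE x0).
split=> q.
  have -> : ampl phi T = \matrix_(i, j) (fun y => lam *: U (T i j (V y))).
    by apply/matrixP => i j; rewrite !mxE phiE.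
  exact: (quadratic_transfer _ UD UZ tauK UK VK).
have -> : T = \matrix_(i, j) (fun x => tau lam^-1 *: V (ampl phi T i j (U x))).
  apply/matrixP => i j; rewrite !mxE phiE//; apply/funext => x.
  by rewrite -VZ scalerA mulVf// scale1r !UK.
apply: (quadratic_transfer _ VD VZ tauK VK UK) => // i j.
by rewrite mxE.
Qed.

End Transfer.

Section MainEquivalence.
Variable F : numFieldType.
Hypothesis Farch : forall x : F, 0 <= x -> exists n : nat, x <= n%:R.
Hypothesis Fnorming : norming F.
Variable cj : F -> F.
Hypothesis cj1 : cj 1 = 1.
Hypothesis cjK : involutive cj.
Hypothesis cj_norm : forall t, `|cj t| = `|t|.
Hypothesis bounded_automorphism : forall tau : F -> F,
  (forall s t, tau (s + t) = tau s + tau t) ->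
  (forall s t, tau (s * t) = tau s * tau t) -> tau 1 = 1 ->
  (exists2 d : F, 0 < d & exists n : nat, forall t, `|t| <= d -> `|tau t| <= n%:R) ->
  (forall t, tau t = t) \/ (forall t, tau t = cj t).

(** Here [U] is [alpha]. Continuity of [V] comes from the same gliding hump as that of [U], with
    [sig] in place of [tau], since functionals are transported both ways. *)
Lemma unital_spatial (X Y : completeNormedModType F) (A : set (X -> X))
    (B : set (Y -> Y)) phi psi : quadratic_bijection A B phi psi -> phi id = id ->
  exists (U : X -> Y) (V : Y -> X),
    [/\ lin_map U \/ conjlin_map cj U, continuous U, continuous V, cancel U V /\ cancel V U
      & forall T, A T -> phi T = (fun y => U (T (V y)))].
Proof.
move=> phiP phi1; have Xinf := q_infX phiP.
have [x0 x0_neq0] := nonzero_vector Xinf.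
have [f0 f0d f00] := dual_separates Fnorming x0_neq0.
have [y0 [g0 [g0d g00 phiP0]]] := rank_one_idempotent Fnorming phiP phi1 f0d f00.
have [tau tauP] := choice (phi_scal Fnorming phiP).
pose U := alpha phi f0 y0.
have UD : forall x z, U (x + z) = U x + U z :=
  alphaD Fnorming phiP phi1 f0d f00 g0d g00 phiP0 tauP.
have UZ : forall c x, U (c *: x) = tau c *: U x :=
  alphaZ Fnorming phiP phi1 f0d f00 g0d g00 phiP0 tauP.
have U_eq0 : forall x, U x = 0 -> x = 0 := alpha_eq0 Fnorming phiP phi1 f0d f00 phiP0.
have Uinj : injective U := alpha_inj Fnorming phiP phi1 f0d f00 g0d g00 phiP0 tauP.
have [V VK] := choice (alpha_surj Fnorming phiP phi1 f0d f00 g0d g00 phiP0 tauP).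
have [sig sigK] := choice (tau_surj Fnorming phiP tauP).
have {}VK : cancel V U := VK.
have UK : cancel U V by move=> x; apply: Uinj; exact: VK.
have tauK : cancel tau sig by move=> t; apply: (tau_inj phiP tauP); exact: sigK.
have U_dual (g : Y -> F) : dual g -> exists2 f, dual f & forall x, g (U x) = tau (f x).
  exact: (dual_pullback Fnorming phiP phi1 f0d f00 g0d g00 phiP0 tauP).
have V_dual (f : X -> F) : dual f -> exists2 g, dual g & forall y, f (V y) = sig (g y).
  move=> fd.
  have [g gd gf] := dual_pushforward Fnorming phiP phi1 f0d f00 g0d g00 phiP0 tauP fd.
  by exists g => // y; rewrite -{2}(VK y) gf tauK.
have tau_id_cj : (forall t, tau t = t) \/ (forall t, tau t = cj t).
  apply: bounded_automorphism.
  - exact: (tauD Fnorming phiP phi1 f0d f00 g0d g00 phiP0 tauP).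
  - exact: (tauM Fnorming phiP phi1 f0d f00 g0d g00 phiP0 tauP).
  - exact: (tau1 phiP phi1 tauP).
  - exact: (semilinear_scalar_bounded Farch Fnorming UD U_dual UZ Xinf U_eq0).
have tau_norm t : `|tau t| = `|t| by case: tau_id_cj => ->.
have sig_norm t : `|sig t| = `|t| by rewrite -tau_norm sigK.
have VD y z : V (y + z) = V y + V z by apply: Uinj; rewrite UD !VK.
have VZ c y : V (c *: y) = sig c *: V y by apply: Uinj; rewrite UZ sigK !VK.
exists U, V; split=> //.
- by case: tau_id_cj => h; [left|right] => a x y; rewrite UD UZ h.
- exact: (semilinear_continuous Farch Fnorming UD U_dual UZ tau_norm).
- exact: (semilinear_continuous Farch Fnorming VD V_dual VZ sig_norm).
- move=> T aT; apply/funext => y; rewrite -{1}[y]VK.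
  exact: (phi_alpha Fnorming phiP phi1 f0d f00 g0d g00 phiP0 tauP).
Qed.

Lemma quadratic_scale (X : normedModType F) n (T : 'M[X -> X]_n) lam :
  (forall i j, lin_map (T i j)) -> quadratic_mx T ->
  quadratic_mx (\matrix_(i, j) (fun y => lam *: T i j y)).
Proof. exact: (@quadratic_transfer F X X id id id id). Qed.

(** As [phi id] is a nonzero scalar [mu], the map [mu^-1 *: phi] is unital and still a quadratic
    bijection; [mu] becomes the scalar [lam]. *)
Lemma two_quadratic_spatial (X Y : completeNormedModType F) (A : set (X -> X))
    (B : set (Y -> Y)) phi :
  infinite_dim X -> infinite_dim Y -> standard_op_alg A -> standard_op_alg B ->
  bij_between A B phi -> n_quad_pres A phi 2 ->
  exists (U : X -> Y) (V : Y -> X) (lam : F),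
    (lin_map U \/ conjlin_map cj U) /\ continuous U /\ continuous V /\
    cancel U V /\ cancel V U /\
    (forall T, A T -> phi T = (fun y => lam *: U (T (V y)))).
Proof.
move=> Xinf Yinf sA sB [phiB phiI phiS] q.
(* Outside [B] the inverse takes the arbitrary value [id]. *)
have inv S : exists T, B S -> A T /\ phi T = S.
  by have [/phiS[T hT]|nS] := pselect (B S); [exists T|exists id => /nS].
have [psi psiP] := choice inv.
have phiP : quadratic_bijection A B phi psi.
  split=> // [S /psiP[]//|T aT|S /psiP[]//].
  by have [aPT ePT] := psiP _ (phiB _ aT); exact: phiI.
have [mu hmu] := phi_scal Fnorming phiP 1; rewrite scal1E in hmu.
have mu0 : mu != 0.
  by rewrite -(phi_scal_eq0 Fnorming phiP (c := 1)) ?oner_eq0// scal1E.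
pose phi' T := (fun y => mu^-1 *: phi T y) : Y -> Y.
pose psi' S := psi (fun y => mu *: S y).
have phi'P : quadratic_bijection A B phi' psi'.
  split=> //.
  - by move=> T aT; apply: std_scale => //; exact: phiB.
  - by move=> S bS; apply: (q_psiA phiP); exact: std_scale.
  - move=> T aT; rewrite /psi' /phi' -[RHS](q_phiK phiP aT); congr psi.
    by apply/funext => y; rewrite scalerA divff// scale1r.
  - move=> S bS; rewrite /psi' /phi' (q_psiK phiP); last exact: std_scale.
    by apply/funext => y; rewrite scalerA mulVf// scale1r.
  - move=> T AT; have lT i j : lin_map (ampl phi T i j).
      by rewrite mxE; apply: (std_lin sB); exact: phiB.
    have e1 : ampl phi' T = \matrix_(i, j) (fun y => mu^-1 *: ampl phi T i j y).
      by apply/matrixP => i j; rewrite !mxE.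
    have e2 : ampl phi T = \matrix_(i, j) (fun y => mu *: ampl phi' T i j y).
      apply/matrixP => i j; rewrite !mxE; apply/funext => y.
      by rewrite scalerA divff// scale1r.
    split=> [/(q _ AT) h|h]; first by rewrite e1; exact: quadratic_scale.
    apply/(q _ AT); rewrite e2; apply: quadratic_scale => // i j.
    rewrite e1 mxE => a x y; rewrite lT scalerDr !scalerA.
    by congr (_ *: _ + _); rewrite mulrC.
have phi'1 : phi' id = id.
  by apply/funext => y; rewrite /phi' hmu /scal scalerA mulVf// scale1r.
have [U [V [Ul Uc Vc [UK VK] hphi]]] := unital_spatial phi'P phi'1.
exists U, V, mu; do 5!split=> //.
move=> T aT; apply/funext => y; have /(congr1 (@^~ y)) <- := hphi T aT.
by rewrite /phi' scalerA divff// scale1r.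
Qed.

(** The cycle goes from [n = 2] to the spatial form, from there to every [n], and back by
    specialisation. *)
Lemma quadratic_equivalence : thm1p1_for cj.
Proof.
move=> X Y A B phi Xinf Yinf sA sB bij.
have c23 := @two_quadratic_spatial X Y A B phi Xinf Yinf sA sB bij.
have c31 : (exists (U : X -> Y) (V : Y -> X) (lam : F),
    (lin_map U \/ conjlin_map cj U) /\ continuous U /\ continuous V /\
    cancel U V /\ cancel V U /\
    (forall T, A T -> phi T = (fun y => lam *: U (T (V y))))) ->
    forall n, n_quad_pres A phi n.
  move=> [U [V [lam [Ul [_ [_ [UK [VK hphi]]]]]]]].
  exact: (completely_quadratic_preserving cj1 cjK Xinf sA sB bij Ul UK VK hphi).
by split; split=> // h; [apply: c31; exact: c23 | exact: c31].
Qed.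

End MainEquivalence.

(* F = R (any realType, conjugation = identity) and F = C = R[i]
   (with complex conjugation). *)
Theorem theorem1p1 (R : realType) :
  thm1p1_for (F := R) id /\ thm1p1_for (F := R[i]) (@Num.conj_op R[i]).
Proof.
split.
  apply: quadratic_equivalence => //.
  - exact: arch_real.
  - exact: norming_real.
  - move=> tau tD _ t1 tb; left => t.
    by apply: (tau_fixes (@arch_real R) tD t1 tb) => n; exact: real_approx.
apply: quadratic_equivalence.
- exact: arch_complex.
- exact: norming_complex.
- exact: rmorph1.
- exact: conjCK.
- exact: norm_conjC.
- exact: bounded_automorphism_complex.
Qed.
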